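(* Let $(\mathfrak h,(H_i,L_i)_{i\in I})$ be a linear Coxeter system with linear Coxeter group $\mathcal W$, closed fundamental chamber $\overline C$ and Tits cone $X$. Let $Y\subseteq X$ be a $\mathcal W$-invariant convex subcone containing $0$. If $\mathcal W$ acts faithfully on $Y$, then $\big(\mathcal R(Y),\ \{1\varepsilon(R)\mid R\in\Upsilon\},\ \{\sigma_i\varepsilon(Y)\mid i\in I\}\big)$ is a generalized Renner-Coxeter system. The unit group $\mathcal R(Y)^\times$ is isomorphic to the Coxeter group $\mathcal W$, and the semilattice of idempotents $E(\mathcal R(Y))$ is isomorphic to the face lattice $\mathrm{Fa}(Y)$, by the maps $$\mathcal W\to\mathcal R(Y)^\times,\ \sigma\mapsto\sigma\varepsilon(Y)\qquad\text{and}\qquad\mathrm{Fa}(Y)\to E(\mathcal R(Y)),\ R\mapsto1\varepsilon(R).$$ If we identify $\{1\varepsilon(R)\mid R\in\Upsilon\}$ with $\Upsilon$, and $\{\sigma_i\varepsilon(Y)\mid i\in I\}$ with $I$, then the type, lower type, upper type maps of the generalized Renner-Coxeter system coincide with $\upsilon,\upsilon_*,\upsilon^*:\Upsilon\to\mathcal P(I)$, respectively.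
   Context: $\mathbb R^+=(0,\infty)$. A convex cone is a subset of a real vector space closed under addition and under multiplication by elements of $\mathbb R^+$. $\mathrm{ri}$ denotes the relative interior of a finite-dimensional convex set. For a convex cone $K$ containing $0$, a face of $K$ is a convex cone $F\subseteq K$ with $(K\setminus F)+K\subseteq K\setminus F$; $\mathrm{Fa}(K)$ is the set of nonempty faces, ordered by inclusion (a complete lattice with meet given by intersection). Linear Coxeter systems. Let $\mathfrak h$ be a finite-dimensional real vector space, $n\ge1$, $I=\{1,\dots,n\}$. For a zero-based closed ray $H\subseteq\mathfrak h$ put $H^{\ge0}=\{\lambda\in\mathfrak h^*\mid\lambda(h)\ge0\ \forall h\in H\}$, $H^{>0}=\{\lambda\mid\lambda(h)>0\ \forall h\in H\setminus\{0\}\}$, $H^{=0}=\{\lambda\mid\lambda(h)=0\ \forall h\in H\}$. A linear Coxeter system $(\mathfrak h,(H_i,L_i)_{i\in I})$ consists of zero-based closed rays $H_i\subseteq\mathfrak h$, $L_i\subseteq\mathfrak h^*$ with $L_i\setminus\{0\}\subseteq H_i^{>0}$ such that: (1) the closed fundamental chamber $\overline C=\bigcap_{i\in I}H_i^{\ge0}$ spans $\mathfrak h^*$, and $\overline C\cap H_i^{=0}$, $i\in I$, are its pairwise different faces of codimension 1; (2) with $C=\bigcap_{i\in I}H_i^{>0}$ and $\mathcal W$ (the linear Coxeter group) the group generated by the reflections $\sigma_i$ on $\mathfrak h^*$ at the hyperplane $H_i^{=0}$ along the line $L_i\cup(-L_i)$, one has $\sigma C\cap C=\emptyset$ for all $\sigma\in\mathcal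 W\setminus\{1\}$. Then $(\mathcal W,(\sigma_i)_{i\in I})$ is a Coxeter system. The Tits cone is the convex cone $X=\bigcup_{\sigma\in\mathcal W}\sigma\overline C$. $\Upsilon=\{R\in\mathrm{Fa}(Y)\mid\mathrm{ri}(R)\cap\overline C\ne\emptyset\}$. For $R\in\Upsilon$: $\upsilon(R)=\{i\in I\mid\sigma_iR=R\}$, $\upsilon_*(R)=\{i\in I\mid\sigma_i\text{ fixes }R\text{ pointwise}\}$, $\upsilon^*(R)=\upsilon(R)\setminus\upsilon_*(R)$. $\mathcal P(S)$ denotes the power set of $S$. The monoid $\mathcal R(Y)$. $\mathcal W\ltimes\mathrm{Fa}(Y)$ is the set $\mathcal W\times\mathrm{Fa}(Y)$ with multiplication $(\sigma,R)\cdot(\tau,T)=(\sigma\tau,\tau^{-1}R\cap T)$ and unit $(1,Y)$. The relation $(\sigma,R)\sim(\sigma',R')$ iff $R=R'$ and $\sigma^{-1}\sigma'\in Z_{\mathcal W}(R)$, where $Z_{\mathcal W}(R)$ is the pointwise stabilizer of $R$, is a congruence; $\mathcal R(Y)=(\mathcal W\ltimes\mathrm{Fa}(Y))/\!\sim$, and $\sigma\varepsilon(R)$ denotes the class of $(\sigma,R)$. Generalized Renner-Coxeter systems. For a monoid $\mathcal R$ with unit group $\mathcal R^\times$, the set of idempotents $E(\mathcal R)$ is partially ordered by $e\le f$ iff $ef=fe=e$. $\mathcal R$ is factorisable if $E(\mathcal R)$ is a commutative submonoid and $\mathcal R=\mathcal R^\times E(\mathcal R)=E(\mathcal R)\mathcal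 R^\times$. A triple $(\mathcal R,\Lambda,\mathcal S)$ is a generalized Renner-Coxeter system if: (a) $\mathcal R$ is a factorisable monoid; (b) $(\mathcal R^\times,\mathcal S)$ is a Coxeter system; (c) $\Lambda$ is a sub-semilattice of $E(\mathcal R)$ and a cross section for the action of $\mathcal R^\times$ on $E(\mathcal R)$ by conjugation; (d) for every pair $e_1\le e_2$ in $E(\mathcal R)$ there exist $x\in\mathcal R^\times$ and a pair $f_1\le f_2$ in $\Lambda$ with $e_1=xf_1x^{-1}$, $e_2=xf_2x^{-1}$; (e) for every $e\in\Lambda$ the subgroups $\{x\in\mathcal R^\times\mid xe=ex\}$ and $\{x\in\mathcal R^\times\mid xe=ex=e\}$ are standard parabolic (i.e. generated by subsets of $\mathcal S$); (f) the map $\lambda^*:(\Lambda,\le)\to(\mathcal P(\mathcal S),\subseteq)$, $\lambda^*(e)=\{s\in\mathcal S\mid se=es\ne e\}$, is order preserving. The type map, lower type map and upper type map of the system are $\lambda(e)=\{s\in\mathcal S\mid se=es\}$, $\lambda_*(e)=\{s\in\mathcal S\mid se=es=e\}$ and $\lambda^*(e)$, respectively. *)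

(* Defs.v *)
From HB Require Import structures.
From mathcomp Require Import all_boot all_order all_algebra.
From mathcomp Require Import all_classical all_reals all_analysis.

Set Implicit Arguments.
Unset Strict Implicit.
Unset Printing Implicit Defensive.

Import Order.TTheory GRing.Theory Num.Theory.
Import numFieldNormedType.Exports.

Local Open Scope classical_set_scope.
Local Open Scope ring_scope.

Section Groups.
Local Open Scope group_scope.
Variable G : groupType.
Implicit Types (A B : set G) (x y s t : G).

Definition is_subgroup B : Prop :=
  [/\ B 1, forall x y, B x -> B y -> B (x * y) & forall x, B x -> B x^-1].

Definition generated A : set G := smallest is_subgroup A.

Lemma generated_subgroup A : is_subgroup (generated A).
Proof.
split=> [B [[B1 _ _] _]|x y Ax Ay B BA|x Ax B BA] //.
- by have [[_ BM _] _] := BA; apply: BM; [apply: Ax|apply: Ay].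
- by have [[_ _ BV] _] := BA; apply: BV; apply: Ax.
Qed.

Definition gen_group A : Type := set_type (generated A).
HB.instance Definition _ A := Choice.on (gen_group A).

Section GenGroup.
Variable A : set G.
Implicit Types u v w : gen_group A.

Definition gen_one : gen_group A :=
  exist (fun x => x \in generated A) 1
    (mem_set (let: And3 p _ _ := generated_subgroup A in p)).

Fact gen_mul_subproof u v : val u * val v \in generated A.
Proof.
by apply/mem_set; case: (generated_subgroup A) => _ + _; apply; apply/set_mem/valP.
Qed.
Definition gen_mul u v : gen_group A :=
  exist (fun x => x \in generated A) _ (gen_mul_subproof u v).

Fact gen_inv_subproof u : (val u)^-1 \in generated A.
Proof.
by apply/mem_set; case: (generated_subgroup A) => _ _; apply; apply/set_mem/valP.
Qed.
Definition gen_inv u : gen_group A :=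
  exist (fun x => x \in generated A) _ (gen_inv_subproof u).

Fact gen_mulA : associative gen_mul.
Proof. by move=> u v w; apply: val_inj; rewrite /= mulgA. Qed.
Fact gen_mul1 : left_id gen_one gen_mul.
Proof. by move=> u; apply: val_inj; rewrite /= mul1g. Qed.
Fact gen_mulr1 : right_id gen_one gen_mul.
Proof. by move=> u; apply: val_inj; rewrite /= mulg1. Qed.
Fact gen_mulV : left_inverse gen_one gen_inv gen_mul.
Proof. by move=> u; apply: val_inj; rewrite /= mulVg. Qed.
Fact gen_mulrV : right_inverse gen_one gen_inv gen_mul.
Proof. by move=> u; apply: val_inj; rewrite /= mulgV. Qed.
End GenGroup.

HB.instance Definition _ A := isGroup.Build (gen_group A)
  (@gen_mulA A) (@gen_mul1 A) (@gen_mulr1 A) (@gen_mulV A) (@gen_mulrV A).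

Definition has_order x (m : nat) : Prop :=
  [/\ (0 < m)%N, x ^+ m = 1 &
      forall k : nat, (0 < k < m)%N -> x ^+ k <> 1].

(* [S] is a generating set of elements of order 2, and the relations
   (s t)^m(s,t) = 1, for all s, t in [S] such that s t has finite order m(s,t),
   form a presentation of the group, in the sense of the universal property. *)
Definition coxeter_system (S : set G) : Prop :=
  [/\ generated S = [set: G],
      forall s, S s -> has_order s 2 &
      forall (K : groupType) (f : G -> K),
        (forall s t m, S s -> S t -> has_order (s * t) m ->
           (f s * f t) ^+ m = 1) ->
        exists g : {multiplicative G -> K}, forall s, S s -> g s = f s].

Definition standard_parabolic (S P : set G) : Prop :=
  exists2 J, J `<=` S & P = generated J.

End Groups.

Section Monoids.
Local Open Scope group_scope.
Variable M : monoidType.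

Definition units : set M := [set x | exists y, x * y = 1 /\ y * x = 1].

Definition unit_group : Type := set_type units.
HB.instance Definition _ := Choice.on unit_group.
Implicit Types u v w : unit_group.

Fact unit_one_subproof : (1 : M) \in units.
Proof. by apply/mem_set; exists 1; rewrite mulg1. Qed.
Definition unit_one : unit_group :=
  exist (fun x => x \in units) _ unit_one_subproof.

Fact unit_mul_subproof u v : val u * val v \in units.
Proof.
have [[x [ux xu]] [y [vy yv]]] := (set_mem (valP u), set_mem (valP v)).
apply/mem_set; exists (y * x); split.
- by rewrite mulgA -(mulgA (val u)) vy mulg1.
- by rewrite mulgA -(mulgA y) xu mulg1.
Qed.
Definition unit_mul u v : unit_group :=
  exist (fun x => x \in units) _ (unit_mul_subproof u v).

Definition unit_inv_val u : M :=
  xget 1 [set y | val u * y = 1 /\ y * val u = 1].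
Fact unit_inv_valP u :
  val u * unit_inv_val u = 1 /\ unit_inv_val u * val u = 1.
Proof. by have := xgetPex (1 : M) (set_mem (valP u)). Qed.
Fact unit_inv_subproof u : unit_inv_val u \in units.
Proof.
by apply/mem_set; exists (val u); have [] := unit_inv_valP u.
Qed.
Definition unit_inv u : unit_group :=
  exist (fun x => x \in units) _ (unit_inv_subproof u).

Fact unit_mulA : associative unit_mul.
Proof. by move=> u v w; apply: val_inj; rewrite /= mulgA. Qed.
Fact unit_mul1 : left_id unit_one unit_mul.
Proof. by move=> u; apply: val_inj; rewrite /= mul1g. Qed.
Fact unit_mulr1 : right_id unit_one unit_mul.
Proof. by move=> u; apply: val_inj; rewrite /= mulg1. Qed.
Fact unit_mulV : left_inverse unit_one unit_inv unit_mul.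
Proof. by move=> u; apply: val_inj; have [] := unit_inv_valP u. Qed.
Fact unit_mulrV : right_inverse unit_one unit_inv unit_mul.
Proof. by move=> u; apply: val_inj; have [] := unit_inv_valP u. Qed.

HB.instance Definition _ := isGroup.Build unit_group
  unit_mulA unit_mul1 unit_mulr1 unit_mulV unit_mulrV.

Definition idempotents : set M := [set e | e * e = e].

Definition idem_le (e f : M) : Prop := e * f = e /\ f * e = e.

Definition factorisable : Prop :=
  [/\ idempotents 1,
      forall e f, idempotents e -> idempotents f -> idempotents (e * f),
      forall e f, idempotents e -> idempotents f -> e * f = f * e,
      forall x, exists u e : M, [/\ units u, idempotents e & x = u * e] &
      forall x, exists e u : M, [/\ idempotents e, units u & x = e * u]].

Definition type_map (S : set M) (e : M) : set M :=
  [set s | S s /\ s * e = e * s].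
Definition lower_type_map (S : set M) (e : M) : set M :=
  [set s | S s /\ (s * e = e * s /\ e * s = e)].
Definition upper_type_map (S : set M) (e : M) : set M :=
  [set s | S s /\ (s * e = e * s /\ e * s <> e)].

Definition conj_by (x : unit_group) (e : M) : M := val x * e * val x^-1.

Record renner_coxeter_system (Lam S : set M) : Prop := RennerCoxeterSystem {
  rcs_factorisable : factorisable;
  rcs_gen_units : S `<=` units;
  rcs_coxeter : coxeter_system [set x : unit_group | S (val x)];
  rcs_lam_idem : Lam `<=` idempotents;
  rcs_lam_meet : forall e f, Lam e -> Lam f -> Lam (e * f);
  rcs_cross_section : forall e, idempotents e ->
    exists! f, Lam f /\ exists x : unit_group, e = conj_by x f;
  rcs_pairs : forall e1 e2, idempotents e1 -> idempotents e2 ->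
    idem_le e1 e2 ->
    exists (x : unit_group) (f1 f2 : M),
      [/\ Lam f1, Lam f2, idem_le f1 f2, e1 = conj_by x f1 &
          e2 = conj_by x f2];
  rcs_parabolic : forall e, Lam e ->
    standard_parabolic [set x : unit_group | S (val x)]
      [set x : unit_group | val x * e = e * val x];
  rcs_lower_parabolic : forall e, Lam e ->
    standard_parabolic [set x : unit_group | S (val x)]
      [set x : unit_group | val x * e = e * val x /\ e * val x = e];
  rcs_upper_mono : forall e f, Lam e -> Lam f -> idem_le e f ->
    upper_type_map S e `<=` upper_type_map S f }.

End Monoids.

Section Cones.
Variables (R : realType) (V : vectType R).
Implicit Types (A F K : set V) (U : {vspace V}).

Definition convex_cone K : Prop :=
  (forall x y, K x -> K y -> K (x + y)) /\
  (forall (t : R) x, 0 < t -> K x -> K (t *: x)).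

Definition is_face K F : Prop :=
  [/\ convex_cone F, F `<=` K &
      forall x y, (K `\` F) x -> K y -> (K `\` F) (x + y)].

Definition faces K : set (set V) := [set F | is_face K F /\ F !=set0].

Definition is_span A U : Prop :=
  A `<=` [set x | x \in U] /\
  forall U', A `<=` [set x | x \in U'] -> (U <= U')%VS.

(* Dimensions of cones are those of their linear spans. *)
Definition codim1_in K F : Prop :=
  exists U U', [/\ is_span K U, is_span F U' & (\dim U').+1 = \dim U].

Definition affine_hull A : set V :=
  [set x | exists (m : nat) (a : 'I_m -> R) (p : 'I_m -> V),
     [/\ forall i, A (p i), \sum_i a i = 1 & x = \sum_i a i *: p i]].

(* Interior of [A] relative to its affine hull. The topology of [V] is the one
   of the maximum norm of the coordinates in the basis [vbasis fullv]. *)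
Definition relint A : set V :=
  [set x | affine_hull A x /\
     exists2 e : R, 0 < e &
       forall y, affine_hull A y ->
         `|passmx.rVof (vbasis {:V}) (y - x)| < e -> A y].

Definition is_ray A : Prop :=
  exists2 v : V, v != 0 & A = [set t *: v | t in [set t : R | 0 <= t]].

End Cones.

Section GeneralLinear.
Variables (R : realType) (V : vectType R).

Definition GL : Type := {f : 'End(V) | lker f == 0%VS}.
HB.instance Definition _ := Choice.on GL.

Definition gl_fun (f : GL) : V -> V := fun x => val f x.
Coercion gl_fun : GL >-> Funclass.

Implicit Types f g k : GL.

Lemma gl_inj f : injective f.
Proof. by move=> x y; apply: (lker0P (valP f)). Qed.

Fact gl_one_subproof : lker (\1%VF : 'End(V)) == 0%VS.
Proof. by apply/lker0P => x y; rewrite !lfunE. Qed.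
Definition gl_one : GL :=
  exist (fun f : 'End(V) => lker f == 0%VS) _ gl_one_subproof.

Fact gl_mul_subproof f g : lker (val f \o val g)%VF == 0%VS.
Proof. by apply/lker0P=> x y; rewrite !lfunE /= => /(@gl_inj f) /(@gl_inj g). Qed.
Definition gl_mul f g : GL :=
  exist (fun f : 'End(V) => lker f == 0%VS) _ (gl_mul_subproof f g).

Fact gl_inv_subproof f : lker (val f)^-1%VF == 0%VS.
Proof.
apply/lker0P; apply: (can_inj (g := val f)); exact: lker0_lfunVK (valP f).
Qed.
Definition gl_inv f : GL :=
  exist (fun f : 'End(V) => lker f == 0%VS) _ (gl_inv_subproof f).

Fact gl_mulA : associative gl_mul.
Proof. by move=> f g k; apply: val_inj; rewrite /= comp_lfunA. Qed.
Fact gl_mul1 : left_id gl_one gl_mul.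
Proof. by move=> f; apply: val_inj; rewrite /= comp_lfun1l. Qed.
Fact gl_mulr1 : right_id gl_one gl_mul.
Proof. by move=> f; apply: val_inj; rewrite /= comp_lfun1r. Qed.
Fact gl_mulV : left_inverse gl_one gl_inv gl_mul.
Proof. by move=> f; apply: val_inj; rewrite /= lker0_compVf ?(valP f). Qed.
Fact gl_mulrV : right_inverse gl_one gl_inv gl_mul.
Proof. by move=> f; apply: val_inj; rewrite /= lker0_compfV ?(valP f). Qed.

HB.instance Definition _ := isGroup.Build GL
  gl_mulA gl_mul1 gl_mulr1 gl_mulV gl_mulrV.

Lemma gl1E x : (1%g : GL) x = x.
Proof. by rewrite /gl_fun /= lfunE. Qed.
Lemma glME f g x : gl_fun (f * g)%g x = f (g x).
Proof. by rewrite /gl_fun /= lfunE. Qed.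
Lemma glVK f x : gl_fun f^-1%g (f x) = x.
Proof. by rewrite -glME mulVg gl1E. Qed.
Lemma glKV f x : f (gl_fun f^-1%g x) = x.
Proof. by rewrite -glME mulgV gl1E. Qed.

End GeneralLinear.

Section LinearCoxeter.
Variables (R : realType) (h : vectType R).
Local Notation dual := ('Hom(h, R^o)).

Section Reflection.
Implicit Types (H : set h) (L : set dual).

Definition ge0_on H : set dual := [set l | forall x, H x -> 0 <= (l x : R)].
Definition gt0_on H : set dual :=
  [set l | forall x, H x -> x != 0 -> 0 < (l x : R)].
Definition eq0_on H : set dual := [set l | forall x, H x -> l x = 0].

Definition is_reflection H L (s : GL dual) : Prop :=
  (forall l, eq0_on H l -> s l = l) /\ (forall l, L l -> s l = - l).

(* Definite description: under the conditions imposed on the pairs (H_i, L_i),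
   [is_reflection H L] has exactly one solution, see [reflectionP]. *)
Definition reflection H L : GL dual := xget 1%g (is_reflection H L).

Definition refl_fun (v : h) (a l : dual) : dual :=
  l - (2%:R * (l v : R) / (a v : R)) *: a.

Fact refl_fun_linear (v : h) (a : dual) : linear (refl_fun v a).
Proof.
move=> k l m; rewrite /refl_fun add_lfunE scale_lfunE.
rewrite scalerBr scalerA addrACA -opprD -scalerDl; congr (_ - _ *: _).
by rewrite mulrDr mulrDl !mulrA (mulrC 2%:R k).
Qed.
HB.instance Definition _ (v : h) (a : dual) :=
  GRing.isLinear.Build R dual dual _ (refl_fun v a) (refl_fun_linear v a).

Fact refl_fun_invol (v : h) (a : dual) : (a v : R) != 0 -> involutive (refl_fun v a).
Proof.
move=> av l; rewrite {1}/refl_fun; set l' := refl_fun v a l.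
have -> : l' v = - (l v : R).
  rewrite /l' /refl_fun add_lfunE opp_lfunE scale_lfunE /= -[_ *: _]/(_ * _).
  by rewrite divfK // mulr_natl mulr2n opprD addNKr.
by rewrite /l' /refl_fun mulrN mulNr scaleNr opprK subrK.
Qed.

Lemma reflectionP H L : is_ray H -> is_ray L -> L `\ 0 `<=` gt0_on H ->
  is_reflection H L (reflection H L) /\
  forall s, is_reflection H L s -> s = reflection H L.
Proof.
move=> [v v0 eH] [a a0 eL] LH.
have Hv : H v by rewrite eH; exists 1; rewrite ?scale1r //= ler01.
have La : L a by rewrite eL; exists 1; rewrite ?scale1r //= ler01.
have av : 0 < (a v : R).
  by apply: (LH a) => //; split=> // /eqP; rewrite (negPf a0).
have av0 : (a v : R) != 0 by rewrite gt_eqF.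
have sE l : linfun (refl_fun v a) l = refl_fun v a l by rewrite lfunE.
have s_inj : lker (linfun (refl_fun v a)) == 0%VS.
  by apply/lker0P => l m; rewrite !sE => /(inv_inj (refl_fun_invol av0)).
have ex : is_reflection H L (exist (fun f : 'End(_) => lker f == 0%VS) _ s_inj).
  split=> l; rewrite /gl_fun /= sE /refl_fun.
    by move=> /(_ v Hv) ->; rewrite mulr0 mul0r scale0r subr0.
  rewrite eL => -[t _ <-]; rewrite scale_lfunE -[_ *: (a v : R^o)]/(t * (a v : R)).
  rewrite mulrA mulfK // mulr_natl mulr2n scalerDl opprD addrA subrr.
  by rewrite sub0r.
have uniq (s s' : GL dual) : is_reflection H L s -> is_reflection H L s' -> s = s'.
  move=> [s0 sL] [s0' sL']; apply: val_inj; apply/lfunP => l.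
  pose c : R := (l v : R) / (a v : R).
  have lE : l = (l - c *: a) + c *: a by rewrite subrK.
  have l0 : eq0_on H (l - c *: a).
    move=> x; rewrite eH => -[t _ <-]; rewrite linearZ /=.
    rewrite add_lfunE opp_lfunE scale_lfunE /= -[_ *: (a v : R^o)]/(_ * _).
    by rewrite /c divfK // subrr scaler0.
  have E (u : GL dual) : is_reflection H L u -> val u l = (l - c *: a) - c *: a.
    move=> [u0 uL]; rewrite -/(gl_fun u l).
    have -> : u l = u (l - c *: a) + c *: u a.
      by rewrite {1}lE /gl_fun linearD; congr (_ + _); exact: linearZ.
    by rewrite u0 // uL // scalerN.
  by rewrite !E.
have refl : is_reflection H L (reflection H L).
  by rewrite /reflection; have := xgetPex 1%g (ex_intro (is_reflection H L) _ ex).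
by split=> // s /uniq; apply.
Qed.

End Reflection.

Section Chamber.
Variables (n : nat) (H : 'I_n -> set h) (L : 'I_n -> set dual).

Definition closed_chamber : set dual := [set l | forall i, ge0_on (H i) l].
Definition open_chamber : set dual := [set l | forall i, gt0_on (H i) l].
Definition reflections : set (GL dual) :=
  range (fun i => reflection (H i) (L i)).
Definition wall (i : 'I_n) : set dual := closed_chamber `&` eq0_on (H i).

End Chamber.

Record linear_coxeter_system (n : nat) := LinearCoxeterSystem {
  lcs_H : 'I_n -> set h;
  lcs_L : 'I_n -> set dual;
  lcs_n_gt0 : (0 < n)%N;
  lcs_H_ray : forall i, is_ray (lcs_H i);
  lcs_L_ray : forall i, is_ray (lcs_L i);
  lcs_L_pos : forall i, lcs_L i `\ 0 `<=` gt0_on (lcs_H i);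
  lcs_chamber_span : is_span (closed_chamber lcs_H) fullv;
  lcs_walls :
    [set F | faces (closed_chamber lcs_H) F /\
             codim1_in (closed_chamber lcs_H) F] = range (wall lcs_H);
  lcs_walls_inj : injective (wall lcs_H);
  lcs_chamber_disj : forall w : GL dual,
    generated (reflections lcs_H lcs_L) w -> w <> 1%g ->
    (w @` open_chamber lcs_H) `&` open_chamber lcs_H = set0 }.

Section System.
Variables (n : nat) (S : linear_coxeter_system n).

Definition chamber : set dual := closed_chamber (lcs_H S).

Definition cox_group : Type := gen_group (reflections (lcs_H S) (lcs_L S)).
HB.instance Definition _ := Group.on cox_group.

Definition cox_fun (w : cox_group) : dual -> dual := gl_fun (val w).
Coercion cox_fun : cox_group >-> Funclass.

Fact cox_refl_subproof (i : 'I_n) :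
  reflection (lcs_H S i) (lcs_L S i)
    \in generated (reflections (lcs_H S) (lcs_L S)).
Proof. by apply/mem_set; apply: sub_gen_smallest; exists i. Qed.
Definition cox_refl (i : 'I_n) : cox_group :=
  exist (fun x => x \in generated (reflections (lcs_H S) (lcs_L S))) _ (cox_refl_subproof i).

Definition tits_cone : set dual := \bigcup_(w in [set: cox_group]) (w @` chamber).

Lemma cox1E x : (1%g : cox_group) x = x.
Proof. exact: gl1E. Qed.
Lemma coxME (v w : cox_group) x : cox_fun (v * w)%g x = v (w x).
Proof. exact: glME. Qed.
Lemma coxVK (w : cox_group) x : cox_fun w^-1%g (w x) = x.
Proof. exact: glVK. Qed.
Lemma coxKV (w : cox_group) x : w (cox_fun w^-1%g x) = x.
Proof. exact: glKV. Qed.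
Lemma coxD (w : cox_group) x y : w (x + y) = w x + w y.
Proof. by rewrite /cox_fun /gl_fun linearD. Qed.
Lemma coxZ (w : cox_group) (t : R) x : w (t *: x) = t *: w x.
Proof. by rewrite /cox_fun /gl_fun linearZ. Qed.
Lemma cox0 (w : cox_group) : w 0 = 0.
Proof. by rewrite /cox_fun /gl_fun linear0. Qed.

Record invariant_subcone := InvariantSubcone {
  isc_set :> set dual;
  isc_sub : isc_set `<=` tits_cone;
  isc_cone : convex_cone isc_set;
  isc_0 : isc_set 0;
  isc_inv : forall w : cox_group, w @` isc_set `<=` isc_set }.

Section FaceMonoid.
Variable Y : invariant_subcone.

Definition acts_faithfully : Prop :=
  forall w : cox_group, (forall y, isc_set Y y -> w y = y) -> w = 1%g.

Definition face : Type := set_type (faces Y).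
HB.instance Definition _ := Choice.on face.
Definition face_set (F : face) : set dual := val F.
Coercion face_set : face >-> set.

Implicit Types (F T : face) (w v : cox_group).

Lemma faceP F : faces Y F.
Proof. exact/set_mem/(valP F). Qed.

Lemma face_eqP F T : (F : set dual) = T -> F = T.
Proof. exact: val_inj. Qed.

Lemma face0 F : (F : set dual) 0.
Proof.
have [[_ FY Fmax] [x Fx]] := faceP F; apply: contrapT => F0.
by have [_] := Fmax 0 x (conj (isc_0 Y) F0) (FY _ Fx); rewrite add0r.
Qed.

Fact face_top_subproof : (Y : set dual) \in faces Y.
Proof.
apply/mem_set; split; last by exists 0; exact: isc_0.
by split=> // [|x y []//]; exact: isc_cone.
Qed.
Definition face_top : face :=
  exist (fun A : set dual => A \in faces Y) _ face_top_subproof.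

Fact face_meet_subproof F T : (F : set dual) `&` T \in faces Y.
Proof.
have [[[FD FZ] FY Fmax] _] := faceP F; have [[[TD TZ] TY Tmax] _] := faceP T.
apply/mem_set; split; last by exists 0; split; exact: face0.
split; first split.
- by move=> x y [Fx Tx] [Fy Ty]; split; [apply: FD|apply: TD].
- by move=> t x t0 [Fx Tx]; split; [apply: FZ|apply: TZ].
- by move=> x [/FY].
- move=> x y [Yx /not_andP[nF|nT]] Yy.
  + by have [Yxy nxy] := Fmax x y (conj Yx nF) Yy; split=> // -[].
  + by have [Yxy nxy] := Tmax x y (conj Yx nT) Yy; split=> // -[].
Qed.
Definition face_meet F T : face :=
  exist (fun A : set dual => A \in faces Y) _ (face_meet_subproof F T).

(* The face w^-1 F, the image of F under the inverse of w. *)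
Fact face_preim_subproof w F : w @^-1` (F : set dual) \in faces Y.
Proof.
have invY (v : cox_group) x : isc_set Y x -> isc_set Y (v x)
  by move=> Yx; apply: isc_inv; exists x.
have [[[FD FZ] FY Fmax] _] := faceP F.
apply/mem_set; split; last by exists 0; rewrite /= cox0; exact: face0.
split; first split.
- by move=> x y /= Fx Fy; rewrite coxD; apply: FD.
- by move=> t x t0 /= Fx; rewrite coxZ; apply: FZ.
- by move=> x /= /FY /(invY w^-1%g); rewrite coxVK.
- move=> x y [Yx nFx] Yy.
  have [Yxy nxy] := Fmax (w x) (w y) (conj (invY w _ Yx) nFx) (invY w _ Yy).
  by split; [apply: (isc_cone Y).1|rewrite /= coxD].
Qed.
Definition face_preim w F : face :=
  exist (fun A : set dual => A \in faces Y) _ (face_preim_subproof w F).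

Lemma face_preimE w F x : (face_preim w F : set dual) x = (F : set dual) (w x).
Proof. by []. Qed.

Definition semidirect : Type := (cox_group * face)%type.
HB.instance Definition _ := Choice.on semidirect.
Implicit Types a b c : semidirect.

Definition sd_one : semidirect := (1%g, face_top).
Definition sd_mul a b : semidirect :=
  ((a.1 * b.1)%g, face_meet (face_preim b.1 a.2) b.2).

Fact sd_mulA : associative sd_mul.
Proof.
move=> [u F] [v T] [w P]; congr pair => /=; first exact: mulgA.
apply: face_eqP; rewrite /= /face_set /= setIA; congr (_ `&` _ `&` _).
by apply/seteqP; split=> x /=; rewrite !face_preimE coxME.
Qed.
Fact sd_mul1 : left_id sd_one sd_mul.
Proof.
move=> [w F]; congr pair => /=; first exact: mul1g.
apply: face_eqP; apply/seteqP; split=> x /= => [[]//|Fx].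
split=> //; apply: (isc_inv (w := w)); exists x => //.
by have [[_ FY _] _] := faceP F; apply: FY.
Qed.
Fact sd_mulr1 : right_id sd_one sd_mul.
Proof.
move=> [w F]; congr pair => /=; first exact: mulg1.
apply: face_eqP; apply/seteqP; split=> x.
  by move=> [/=]; rewrite face_preimE cox1E.
move=> Fx; split; first by rewrite face_preimE cox1E.
by have [[_ FY _] _] := faceP F; apply: FY.
Qed.

HB.instance Definition _ := isMonoid.Build semidirect sd_mulA sd_mul1 sd_mulr1.

Definition pointwise_stab (F : set dual) : set cox_group :=
  [set w | forall x, F x -> w x = x].

Definition sd_sim : rel semidirect := fun a b =>
  `[< a.2 = b.2 /\ pointwise_stab a.2 (a.1^-1 * b.1)%g >].

Lemma sd_simP a b :
  reflect (a.2 = b.2 /\ forall x, (a.2 : set dual) x -> a.1 x = b.1 x)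
          (sd_sim a b).
Proof.
rewrite /sd_sim; apply: (iffP (asboolP _)) => -[eqF ab]; split=> // x Fx.
- by have /(congr1 a.1) := ab x Fx; rewrite coxME coxKV.
- by rewrite coxME -ab // coxVK.
Qed.

Fact sd_sim_refl : reflexive sd_sim.
Proof. by move=> a; apply/sd_simP. Qed.
Fact sd_sim_sym : symmetric sd_sim.
Proof.
suff imp a b : sd_sim a b -> sd_sim b a by move=> a b; apply/idP/idP; apply: imp.
by move=> /sd_simP[e ab]; apply/sd_simP; rewrite -e; split=> // x /ab.
Qed.
Fact sd_sim_trans : transitive sd_sim.
Proof.
move=> b a c /sd_simP[eab ab] /sd_simP[ebc bc]; apply/sd_simP.
split=> [|x ax]; first by rewrite eab.
by rewrite ab // bc // -eab.
Qed.

Canonical sd_sim_equiv := EquivRel sd_sim sd_sim_refl sd_sim_sym sd_sim_trans.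

Lemma sd_sim_mul a a' b b' :
  sd_sim a a' -> sd_sim b b' -> sd_sim (a * b)%g (a' * b')%g.
Proof.
move=> /sd_simP[ea aa] /sd_simP[eb bb]; apply/sd_simP; split=> /=.
  apply: face_eqP; rewrite /face_set /= -ea -eb.
  by apply/seteqP; split=> x [ax bx]; split=> //; move: ax; rewrite !face_preimE bb.
by move=> x [/= ax bx]; rewrite !coxME aa // bb.
Qed.

Definition face_monoid : Type := {eq_quot sd_sim}%qT.
HB.instance Definition _ := Choice.on face_monoid.

(* The class written w eps(F). *)
Definition class_eps w F : face_monoid :=
  \pi_({eq_quot sd_sim})%qT ((w, F) : semidirect).

Implicit Types x y z : face_monoid.

Definition fm_repr x : semidirect := repr (x : {eq_quot sd_sim}%qT).

Definition fm_mul x y : face_monoid :=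
  let a := (fm_repr x * fm_repr y)%g in class_eps a.1 a.2.
Definition fm_one : face_monoid := class_eps 1%g face_top.

Lemma class_epsP w F v T :
  class_eps w F = class_eps v T <-> sd_sim (w, F) (v, T).
Proof. by split=> [/eqmodP//|/eqmodP]. Qed.

Lemma fm_reprK x : class_eps (fm_repr x).1 (fm_repr x).2 = x.
Proof. by rewrite /class_eps -surjective_pairing reprK. Qed.

Lemma fm_repr_class w F : sd_sim (fm_repr (class_eps w F)) (w, F).
Proof. by apply/eqmodP; rewrite reprK. Qed.

Lemma fm_mulE a b :
  fm_mul (class_eps a.1 a.2) (class_eps b.1 b.2) =
  class_eps (a * b)%g.1 (a * b)%g.2.
Proof.
apply/class_epsP; rewrite -!surjective_pairing; apply: sd_sim_mul.
- by have := fm_repr_class a.1 a.2; rewrite -surjective_pairing.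
- by have := fm_repr_class b.1 b.2; rewrite -surjective_pairing.
Qed.

Fact fm_mulA : associative fm_mul.
Proof.
move=> x y z; rewrite -(fm_reprK x) -(fm_reprK y) -(fm_reprK z).
by rewrite !fm_mulE mulgA.
Qed.
Fact fm_mul1 : left_id fm_one fm_mul.
Proof.
by move=> x; rewrite -(fm_reprK x) (fm_mulE 1%g) mul1g.
Qed.
Fact fm_mulr1 : right_id fm_one fm_mul.
Proof.
by move=> x; rewrite -(fm_reprK x) (fm_mulE _ 1%g) mulg1.
Qed.

HB.instance Definition _ := isMonoid.Build face_monoid fm_mulA fm_mul1 fm_mulr1.

Lemma class_epsM w F v T :
  (class_eps w F * class_eps v T)%g =
  class_eps (w * v)%g (face_meet (face_preim v F) T).
Proof. exact: (fm_mulE (w, F) (v, T)). Qed.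

Definition eps F : face_monoid := class_eps 1%g F.
Definition gen_class (i : 'I_n) : face_monoid :=
  class_eps (cox_refl i) face_top.

Definition ups : set face := [set F | relint F `&` chamber !=set0].
Definition ups_type F : set 'I_n :=
  [set i | cox_refl i @` (F : set dual) = F].
Definition ups_lower F : set 'I_n :=
  [set i | forall x : dual, (F : set dual) x -> cox_refl i x = x].
Definition ups_upper F : set 'I_n := ups_type F `\` ups_lower F.

End FaceMonoid.
End System.
End LinearCoxeter.

Arguments ups {R h n S} Y.
Arguments idempotents M : clear implicits.

(* Main.v *)
From HB Require Import structures.
Require Import Defs.
From mathcomp Require Import all_boot all_order all_algebra.
From mathcomp Require Import all_classical all_reals all_analysis.

(* By disjointness of the open chambers, no open chamber w C meets the hyperplane
   of a simple reflection s_i, so w C lies strictly on one side of it. If a word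
   for w leads from C to the negative side of H_i, the letter at which the gallery
   crosses the hyperplane can be deleted to obtain a word for s_i w. This exchange
   property gives the Coxeter presentation (via Matsumoto's theorem), and the facts
   that the closed chamber is a fundamental domain and that the stabilizers of its
   points are standard parabolic.
   The key fact on faces is: if F meets the closed chamber in a relatively interior
   point c, and z in F is negative on H_i, then the segment from c to z meets the
   hyperplane in a relatively interior point of F fixed by s_i, so s_i F = F. By
   induction on the distance of a point of F to the chamber, the faces in Upsilon
   are characterized by this property; stability of Upsilon under intersection, the
   cross section property, the simultaneous conjugation of two comparable faces,
   the parabolicity of the stabilizers and the monotonicity of the upper type map
   all follow. *)

Set Implicit Arguments.
Unset Strict Implicit.
Unset Printing Implicit Defensive.

Import Order.TTheory GRing.Theory Num.Theory.

Local Open Scope classical_set_scope.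
Local Open Scope group_scope.

(** * The exchange condition *)

Section Exchange.
Variables (G : groupType) (I : eqType) (s : I -> G).
Hypothesis s2 : forall i, s i * s i = 1.
Implicit Types (i j : I) (t u v : seq I) (x y : G).

Local Notation wd t := (\prod_(i <- t) s i).

Lemma generated_words (J : set I) :
  generated (s @` J) = [set x | exists2 t, {in t, forall i, J i} & x = wd t].
Proof.
apply/seteqP; split.
  apply: smallest_sub => [|x [i Ji <-]]; last first.
    by exists [:: i]; rewrite ?big_seq1 // => k; rewrite inE => /eqP ->.
  split=> [|x y [t Jt ->] [u Ju ->]|x [t Jt ->]].
  - by exists [::]; rewrite ?big_nil.
  - by exists (t ++ u); rewrite ?big_cat // => k; rewrite mem_cat => /orP[/Jt|/Ju].
  - exists (rev t) => [k|]; first by rewrite mem_rev => /Jt.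
    elim: t {Jt} => [|i t IHt]; first by rewrite !big_nil invg1.
    rewrite rev_cons -cats1 big_cat big_seq1 big_cons invgM IHt.
    by congr (_ * _); apply: (mulgI (s i)); rewrite s2 mulgV.
move=> _ [t Jt ->]; have [g1 gM _] := generated_subgroup (s @` J).
elim: t Jt => [|i t IHt] Jt; first by rewrite big_nil.
rewrite big_cons; apply: gM; last by apply: IHt => k kt; apply: Jt; rewrite inE kt orbT.
by apply: sub_gen_smallest; exists i => //; apply: Jt; rewrite mem_head.
Qed.

Definition reduced t := forall u, wd u = wd t -> (size t <= size u)%N.

Definition exchange := forall i t, reduced t -> ~ reduced (i :: t) ->
  exists t1 j t2, t = t1 ++ j :: t2 /\ s i * wd t = wd (t1 ++ t2).

Hypothesis sE : exchange.
Hypothesis s_gen : generated (range s) = [set: G].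

Lemma reduced_word x : exists2 t, reduced t & wd t = x.
Proof.
have : generated (range s) x by rewrite s_gen.
rewrite generated_words => -[t _ ->].
have [k] := ubnP (size t); elim: k t => // k IHk t tk.
have [tr|] := pselect (reduced t); first by exists t.
move=> /existsNP[u /not_implyP[ut /negP]]; rewrite -ltnNge => us.
by have [v vr vu] := IHk u (leq_trans us tk); exists v; rewrite // vu.
Qed.

Lemma reduced_eq t u : reduced t -> wd u = wd t -> size u = size t -> reduced u.
Proof. by move=> tr ut us v vu; rewrite us; apply: tr; rewrite vu. Qed.

Lemma reduced_catl t u : reduced (t ++ u) -> reduced t.
Proof.
move=> tur v vt; have := tur (v ++ u); rewrite !big_cat vt !size_cat => /(_ erefl).
by rewrite leq_add2r.
Qed.

Lemma reduced_catr t u : reduced (t ++ u) -> reduced u.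
Proof.
move=> tur v vt; have := tur (t ++ v); rewrite !big_cat vt !size_cat => /(_ erefl).
by rewrite leq_add2l.
Qed.

Lemma exchange_descent i t u : reduced t -> reduced (i :: u) -> wd (i :: u) = wd t ->
  exists t1 j t2, t = t1 ++ j :: t2 /\ wd t = wd (i :: t1 ++ t2).
Proof.
move=> tr iur iut.
have [|t1 [j [t2 [tE it]]]] := sE (i := i) tr.
  move=> /(_ u); rewrite big_cons -iut big_cons mulgA s2 mul1g => /(_ erefl) /= tu.
  by have /= ut := iur t (esym iut); have := ltn_trans tu ut; rewrite ltnn.
exists t1, j, t2; split=> //.
by rewrite big_cons -it mulgA s2 mul1g.
Qed.

Fixpoint alt (k : nat) i j := if k is l.+1 then i :: alt l j i else [::].

Lemma size_alt k i j : size (alt k i j) = k.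
Proof. by elim: k i j => //= k IHk i j; rewrite IHk. Qed.

Lemma alt_prefix k m i j : (k <= m)%N -> exists u, alt m i j = alt k i j ++ u.
Proof.
elim: k m i j => [|k IHk] [|m] i j //= km; [by exists [::] | by eexists |].
by have [u ->] := IHk m j i km; exists u.
Qed.

Lemma alt_rcons k i j t l : alt k i j = rcons t l -> t = alt k.-1 i j.
Proof.
elim: k i j t => [|k IHk] i j [|x t] //= [xi].
  by case: k {IHk}.
by move=> tE; rewrite -xi (IHk _ _ _ tE); case: k tE {IHk} => //; case: (t).
Qed.

(** The letters on both sides of [q] agree, so that deleting [q] from an alternating word makes its
    neighbours cancel. *)
Lemma alt_neighbours k i j t p q u : alt k i j = t ++ q :: p :: u ->
  t = [::] \/ exists t', t = rcons t' p.
Proof.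
elim: k i j t => [|k IHk] i j [|x t] //=; first by left.
move=> [xE tE]; right.
have [t0|[t' ->]] := IHk _ _ _ tE; last by exists (x :: t').
exists [::]; move: tE; rewrite t0 -xE /=.
by case: k {IHk} => //= -[|k] //= [_ ->].
Qed.

(* If [i] and [j] are left descents of [x], the exchange condition yields reduced
   words of [x] with longer and longer alternating prefixes, until the two
   alternating words of the same length coincide. *)
Lemma descent_alt k i j x t u :
    i <> j -> reduced (i :: t) -> wd (i :: t) = x ->
    reduced (j :: u) -> wd (j :: u) = x ->
  (exists m v, [/\ (0 < m)%N, reduced (alt m i j ++ v), wd (alt m i j ++ v) = x &
                   wd (alt m i j) = wd (alt m j i)]) \/
  (exists2 v, reduced (alt k i j ++ v) & wd (alt k i j ++ v) = x).
Proof.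
elim: k i j t u => [|k IHk] i j t u ij tr tx ur ux.
  by right; exists (i :: t).
have [[m [v [m0 vr vx mE]]]|[v vr vx]] := IHk j i u t (nesym ij) ur ux tr tx.
  left; exists m, v; split=> //; last by rewrite big_cat -mE -big_cat.
  by apply: (reduced_eq vr); rewrite ?size_cat ?size_alt // !big_cat mE.
have [|t1 [q [t2 [tE itE]]]] := exchange_descent vr tr; first by rewrite vx.
have sz : size (t1 ++ t2) = (k + size v).-1.
  by rewrite -(size_alt k j i) -size_cat tE !size_cat /= addnS.
(* If the deleted letter lies behind the alternating prefix, the new leading [i] lengthens that
   prefix by one. *)
have [kt1|t1k] := leqP k (size t1).
  have altE : alt k.+1 i j ++ drop k t1 ++ t2 = i :: t1 ++ t2.
    rewrite /= catA; congr (_ :: _ ++ _); rewrite -[RHS](cat_take_drop k).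
    congr (_ ++ _); have := congr1 (take k) tE.
    by rewrite takel_cat ?size_alt // take_oversize ?size_alt // takel_cat.
  right; exists (drop k t1 ++ t2); rewrite altE; last by rewrite -vx itE.
  apply: (reduced_eq vr) => //=.
  by rewrite sz size_cat size_alt prednK // -(size_alt k j i) -size_cat tE size_cat /= addnS.
left.
have kE : alt k j i = t1 ++ q :: take (k - (size t1).+1) t2.
  have := congr1 (take k) tE; rewrite take_size_cat ?size_alt // => ->.
  rewrite take_cat ltnNge ltnW //= subnS.
  by case: (k - _)%N (subn_gt0 (size t1) k) => [|l] //; rewrite t1k.
set t3 := take _ _ in kE.
have t2E : t2 = t3 ++ v.
  by move: tE; rewrite kE -catA => /(congr1 (drop (size t1))); rewrite !drop_size_cat //= => -[].
(* If [q] is the last alternating letter, the exchanged word starts with [alt k i j], and cancelling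
   [v] equates the two alternating products. *)
case: t3 => [|p t3] in kE t2E *.
  have k0 : (0 < k)%N by case: (k) kE t1k => //; case: (t1).
  have t1E : i :: t1 = alt k i j.
    by move: kE; rewrite cats1 => /alt_rcons ->; case: (k) k0.
  have altE : wd (alt k i j) = wd (alt k j i).
    by move: itE; rewrite t2E -cat_cons t1E !big_cat => /mulIg.
  exists k, v; split=> //; last by rewrite big_cat altE -big_cat.
  by apply: (reduced_eq vr); rewrite ?size_cat ?size_alt // !big_cat altE.
(* Otherwise [i :: t1] ends in the same [p] that follows [q]; the two cancel and leave a word that
   is too short. *)
have [//|[t1' t1E]] : i :: t1 = [::] \/ exists t', i :: t1 = rcons t' p.
  by apply: (@alt_neighbours k.+1 i j _ p q t3); rewrite /= kE.
have E : wd (t1' ++ t3 ++ v) = wd (alt k j i ++ v).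
  rewrite itE -cat_cons t1E t2E -cats1 -catA /= !big_cat !big_cons !big_cat /=.
  by rewrite !mulgA -(mulgA _ (s p) (s p)) s2 mulg1.
have := vr _ E; have := congr1 size t1E; rewrite size_rcons /= => -[t1s].
rewrite kE !size_cat /= -t1s -!addnA leq_add2l leq_add2r.
by rewrite ltnNge leqnSn.
Qed.

Lemma braid i j x t u :
    i <> j -> reduced (i :: t) -> wd (i :: t) = x ->
    reduced (j :: u) -> wd (j :: u) = x ->
  exists m v, [/\ (0 < m)%N, reduced (alt m i j ++ v), wd (alt m i j ++ v) = x &
                  wd (alt m i j) = wd (alt m j i)].
Proof.
move=> ij tr tx ur ux.
(* An alternating prefix of this length would be longer than the word [i :: t] for [x], so only the
   first alternative survives. *)
have [//|[v vr vx]] := descent_alt (size t).+2 ij tr tx ur ux.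
have := vr (i :: t); rewrite tx vx => /(_ erefl).
by rewrite size_cat size_alt /= addSn ltnNge leq_addr.
Qed.

End Exchange.

(** * From the exchange condition to the Coxeter presentation *)

Lemma alt_order (K : groupType) (I : eqType) (f : I -> K) i j k :
    f i * f i = 1 -> f j * f j = 1 ->
  (f i * f j) ^+ k = 1 <->
  \prod_(l <- alt k i j) f l = \prod_(l <- alt k j i) f l.
Proof.
move=> fi fj.
(* The power is the quotient of the two alternating products, which turns order relations into braid
   relations. *)
suff <- : \prod_(l <- alt k i j) f l * (\prod_(l <- alt k j i) f l)^-1
          = (f i * f j) ^+ k.
  by split=> [/divg1_eq|->]; rewrite ?mulgV.
elim: k i j fi fj => [|k IHk] i j fi fj; first by rewrite /= !big_nil mulgV.
rewrite /= !big_cons invgM -mulgA (mulgA (\prod_(l <- _) _)) IHk //.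
have -> : (f j)^-1 = f j by apply: (mulgI (f j)); rewrite mulgV fj.
elim: k {IHk} => [|k IHk]; first by rewrite expg0 expg1 mul1g.
by rewrite expgS -!mulgA IHk mulgA -expgS.
Qed.

Lemma coxeter_system_exchange (G : groupType) (I : eqType) (s : I -> G) :
  (forall i, s i * s i = 1) -> (forall i, s i <> 1) ->
  generated (range s) = [set: G] -> exchange s ->
  coxeter_system (range s).
Proof.
move=> s2 s1 s_gen sE; split=> // [_ [i _ <-]|K f fP].
  split=> // [|k]; first by rewrite expgS expg1.
  by case: k => [|[|k]] // _; rewrite expg1.
pose F i := f (s i).
have F2 i : F i * F i = 1.
  (* This is the relation of the pair [i], [i], whose product has order 1. *)
  rewrite -[LHS]expg1; apply: fP; [by exists i|by exists i|].
  by split=> // [|k]; [rewrite expg1 s2 | case: k].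
(* Matsumoto: the value of [F] on reduced words depends only on the product. *)
have matsumoto t u : reduced s t -> reduced s u ->
    \prod_(l <- t) s l = \prod_(l <- u) s l ->
    \prod_(l <- t) F l = \prod_(l <- u) F l.
  have [k] := ubnP (size t); elim: k t u => // k IHk t u tk tr ur tu.
  have tus : size t = size u by apply/eqP; rewrite eqn_leq tr // ur.
  case: t u => [|i t] [|j u] //= in tk tr ur tu tus *.
  have sameh l v v' : (size v < k)%N -> reduced s (l :: v) -> reduced s (l :: v') ->
      \prod_(l <- (l :: v)) s l = \prod_(l <- (l :: v')) s l ->
      \prod_(l <- (l :: v)) F l = \prod_(l <- (l :: v')) F l.
    move=> vk vr vr'; rewrite !big_cons => /mulgI vv'; congr (_ * _).
    by apply: IHk => //; [apply: (@reduced_catr _ _ s [:: l])|apply: (@reduced_catr _ _ s [:: l])].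
  have [ij|/eqP ij] := eqVneq i j; first by rewrite -ij in ur tu *; apply: sameh.
  have [m [v [m0 mr mx mE]]] := braid s2 sE ij tr erefl ur (esym tu).
  have mr' : reduced s (alt m j i ++ v).
    by apply: (reduced_eq mr); rewrite ?size_cat ?size_alt // !big_cat mE.
  have FE : \prod_(l <- alt m i j) F l = \prod_(l <- alt m j i) F l.
    apply/alt_order => //; apply: fP; [by exists i|by exists j|].
    (* The exponent [m] is the exact order: a smaller [l] would give the prefix [alt l.+1 j i] of a
       reduced word the product of a word with [l.-1] letters. *)
    split=> // [|l /andP[l0 lm] /alt_order].
      by apply/alt_order.
    move=> /(_ (s2 _) (s2 _)) lE.
    have [w wE] := alt_prefix j i lm; move: mr'; rewrite wE => /reduced_catl/reduced_catl.
    move=> /(_ (alt l.-1 i j)); rewrite size_alt /= size_alt => lr.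
    have /lr : \prod_(k <- alt l.-1 i j) s k = \prod_(k <- (j :: alt l i j)) s k.
      by rewrite big_cons lE; case: (l) l0 => //= l' _; rewrite big_cons mulgA s2 mul1g.
    by case: (l) l0 => //= l' _; rewrite ltnNge leqnSn.
  have [m' mE'] : exists m', m = m'.+1 by case: (m) m0 => // m' _; exists m'.
  (* The words starting with the two alternating words share their first letters with [i :: t] and
     [j :: u] respectively, so induction applies on both sides of the braid relation. *)
  transitivity (\prod_(l <- alt m i j ++ v) F l).
    by rewrite mE' /= in mr mx *; apply: sameh => //; rewrite mx.
  rewrite big_cat FE -big_cat; symmetry.
  have : \prod_(i <- (j :: u)) s i = \prod_(i <- alt m j i ++ v) s i.
    by rewrite -tu -mx !big_cat mE.
  by rewrite mE' /= in mr' *; apply: sameh => //; rewrite -ltnS -tus.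
pose rw x := s2val (cid2 (reduced_word s2 s_gen x)).
have rwP x : reduced s (rw x) /\ \prod_(l <- rw x) s l = x.
  by rewrite /rw; case: cid2.
(* The extension evaluates [F] on a chosen reduced word; [matsumoto] makes the choice irrelevant. *)
pose g x := \prod_(l <- rw x) F l.
have gcons i x : reduced s (i :: rw x) -> g (s i * x) = F i * g x.
  move=> ir; rewrite -[RHS](big_cons _ _ _ _ xpredT); apply: matsumoto => //.
    exact: (rwP _).1.
  by rewrite big_cons !(rwP _).2.
have gs i x : g (s i * x) = F i * g x.
  have [/gcons//|nr] := pselect (reduced s (i :: rw x)).
  have [t1 [j [t2 [tE ix]]]] := sE i _ (rwP x).1 nr.
  (* When [i] is a left descent of [x], it can be prepended to a reduced word of [s i * x], and
     [gcons] applies there. *)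
  have {2}-> : x = s i * (s i * x) by rewrite mulgA s2 mul1g.
  rewrite (gcons i (s i * x)) ?mulgA ?F2 ?mul1g //.
  apply: (reduced_eq (rwP x).1); first by rewrite big_cons !(rwP _).2 mulgA s2 mul1g.
  apply/eqP; rewrite eqn_leq (rwP x).1; last first.
    by rewrite big_cons !(rwP _).2 mulgA s2 mul1g.
  rewrite andbT /=; have := (rwP (s i * x)).1 (t1 ++ t2).
  rewrite -ix !(rwP _).2 => /(_ erefl); rewrite tE !size_cat /= addnS.
  by rewrite ltnS.
have g1 : g 1 = 1.
  rewrite /g; have := (rwP 1).1 [::]; rewrite (rwP 1).2 big_nil => /(_ erefl).
  by rewrite leqn0 => /nilP ->; rewrite big_nil.
have gw t x : g (\prod_(l <- t) s l * x) = \prod_(l <- t) F l * g x.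
  elim: t x => [|i t IHt] x; first by rewrite !big_nil !mul1g.
  by rewrite !big_cons -!mulgA gs IHt.
have gM : {morph g : x y / x * y}.
  by move=> x y; rewrite -{1}(rwP x).2 gw.
pose gMx := isMultiplicative.Build G K g gM.
pose g' : {multiplicative G -> K} := HB.pack g gMx.
exists g' => _ [i _ <-].
by rewrite -[s i]mulg1 /= gs g1 !mulg1.
Qed.

(** * Chambers of a linear Coxeter system *)

Section Perturbation.
Local Open Scope ring_scope.

Lemma small_perturbation (R : realFieldType) (I : finType) (P : pred I) (a b : I -> R) :
  (forall k, P k -> 0 < a k) ->
  exists2 e : R, 0 < e & forall k, P k -> 0 < a k + e * b k.
Proof.
move=> a0; pose m := \sum_(k | P k) `|b k| / a k.
have m0 : 0 <= m by apply: sumr_ge0 => k /a0 ak; rewrite divr_ge0 // ltW.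
have m1 : 0 < 1 + m by rewrite ltr_pwDl.
exists (1 + m)^-1; first by rewrite invr_gt0.
move=> k Pk; have ak := a0 _ Pk.
have bm : `|b k| < (1 + m) * a k.
  rewrite -ltr_pdivrMr //; apply: (@le_lt_trans _ _ m); last by rewrite ltrDr.
  rewrite /m (bigD1 k) //= lerDl; apply: sumr_ge0 => l /andP[/a0 al _].
  by rewrite divr_ge0 // ltW.
rewrite -ltrBlDr sub0r -mulrN ltr_pdivrMl //.
by apply: le_lt_trans bm; rewrite -normrN ler_norm.
Qed.

End Perturbation.

Section Geometry.
Local Open Scope ring_scope.
Variables (R : realType) (h : vectType R) (n : nat) (S : linear_coxeter_system h n).
Local Notation dual := ('Hom(h, R^o)).
Local Notation W := (cox_group S).
Implicit Types (i j k : 'I_n) (x y c : dual) (w v u : W) (t : seq 'I_n).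

(** * Coroots, simple roots and the formula for the simple reflections *)

Definition coroot i : h := s2val (cid2 (lcs_H_ray S i)).

Definition pairing i x : R^o := x (coroot i).

Fact pairing_is_linear i : linear (pairing i).
Proof. by move=> a x y; rewrite /pairing add_lfunE scale_lfunE. Qed.
HB.instance Definition _ i :=
  GRing.isLinear.Build R dual R^o _ (pairing i) (pairing_is_linear i).

Lemma pairingZ i (a : R) x : pairing i (a *: x) = a * pairing i x.
Proof. exact: linearZ. Qed.

(** The generator of the ray [L_i] is scaled to pair to 2 with the coroot, which gives the
    reflection its usual form [cox_reflE]. *)
Definition simple_root i : dual :=
  let a := s2val (cid2 (lcs_L_ray S i)) in (2 / pairing i a) *: a.

Lemma ge0_onE i x : ge0_on (lcs_H S i) x <-> 0 <= pairing i x.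
Proof.
rewrite /pairing /coroot; case: cid2 => v /= _ HE; rewrite HE; split.
  by apply; exists 1; rewrite /= ?ler01 // scale1r.
by move=> xv _ [a a0 <-]; rewrite linearZ mulr_ge0.
Qed.

Lemma gt0_onE i x : gt0_on (lcs_H S i) x <-> 0 < pairing i x.
Proof.
rewrite /pairing /coroot; case: cid2 => v /= v0 HE; rewrite HE; split.
  by apply=> //; exists 1; rewrite /= ?ler01 // scale1r.
move=> xv _ [a a0 <-]; rewrite scaler_eq0 negb_or => /andP[a0' _].
by rewrite linearZ mulr_gt0 // lt_def a0' a0.
Qed.

Lemma eq0_onE i x : eq0_on (lcs_H S i) x <-> pairing i x = 0.
Proof.
rewrite /pairing /coroot; case: cid2 => v /= _ HE; rewrite HE; split.
  by apply; exists 1; rewrite /= ?ler01 // scale1r.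
by move=> xv _ [a a0 <-]; rewrite linearZ /= xv scaler0.
Qed.

Lemma chamberE c : chamber S c <-> forall i, 0 <= pairing i c.
Proof. by split=> cc i; apply/ge0_onE/cc. Qed.

Lemma open_chamberE c : open_chamber (lcs_H S) c <-> forall i, 0 < pairing i c.
Proof. by split=> cc i; apply/gt0_onE/cc. Qed.

Lemma wallE i c : wall (lcs_H S) i c <-> chamber S c /\ pairing i c = 0.
Proof. by split=> -[cc /eq0_onE]. Qed.

Lemma simple_rootP i : pairing i (simple_root i) = 2 /\ lcs_L S i (simple_root i).
Proof.
rewrite /simple_root; case: cid2 => a /= a0 LE.
have La : lcs_L S i a by rewrite LE; exists 1; rewrite /= ?ler01 // scale1r.
have pa : 0 < pairing i a.
  by apply/gt0_onE/lcs_L_pos; split=> // /eqP; rewrite (negPf a0).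
split; first by rewrite pairingZ divfK // gt_eqF.
by rewrite LE; exists (2 / pairing i a) => //=; rewrite divr_ge0 // ltW.
Qed.

Lemma pairing_root i : pairing i (simple_root i) = 2.
Proof. exact: (simple_rootP i).1. Qed.

Lemma cox_reflE i x : cox_refl S i x = x - pairing i x *: simple_root i.
Proof.
have [[fixH negL] _] :=
  reflectionP (lcs_H_ray S i) (lcs_L_ray S i) (@lcs_L_pos _ _ _ S i).
set a := simple_root i; pose b : R := pairing i x / 2.
have negR : cox_refl S i a = - a := negL _ (simple_rootP i).2.
have fixR : cox_refl S i (x - b *: a) = x - b *: a.
  by apply: fixH; apply/eq0_onE; rewrite linearB /= pairingZ pairing_root divfK ?subrr.
have {1}-> : x = (x - b *: a) + b *: a by rewrite subrK.
rewrite coxD coxZ negR fixR.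
by rewrite scalerN -addrA -opprD -scalerDl -splitr.
Qed.

Lemma pairing_refl i x : pairing i (cox_refl S i x) = - pairing i x.
Proof.
rewrite cox_reflE linearB /= pairingZ pairing_root mulr_natr mulr2n.
by rewrite opprD addrA subrr sub0r.
Qed.

Lemma refl_fixed i x : cox_refl S i x = x <-> pairing i x = 0.
Proof.
split=> [xE|x0]; last by rewrite cox_reflE x0 scale0r subr0.
by have /eqP := pairing_refl i x; rewrite xE -addr_eq0 -mulr2n mulrn_eq0 => /eqP.
Qed.

Lemma cox_reflK i : (cox_refl S i * cox_refl S i)%g = 1%g.
Proof.
apply: val_inj; apply: val_inj; apply/lfunP => x.
have : cox_fun (cox_refl S i * cox_refl S i)%g x = cox_fun (1%g : W) x; last by [].
rewrite coxME cox1E cox_reflE pairing_refl [X in X - _]cox_reflE.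
by rewrite scaleNr opprK subrK.
Qed.

Lemma cox_refl_neq1 i : cox_refl S i <> 1%g.
Proof.
move=> i1; have /refl_fixed/eqP : cox_refl S i (simple_root i) = simple_root i.
  by rewrite i1 cox1E.
by rewrite pairing_root pnatr_eq0.
Qed.

Local Notation wd t := (\prod_(i <- t) cox_refl S i)%g.

Lemma generated_cox_refl : generated (range (cox_refl S)) = [set: W].
Proof.
rewrite generated_words; last exact: cox_reflK.
apply/seteqP; split=> // w _.
have gl_word (g : GL dual) : generated (reflections (lcs_H S) (lcs_L S)) g ->
    exists t, g = (\prod_(i <- t) reflection (lcs_H S i) (lcs_L S i))%g.
  rewrite /reflections generated_words; first by move=> [t _ ->]; exists t.
  by move=> i; have /(congr1 val) := cox_reflK i.
have [t wE] := gl_word _ (set_mem (valP w)); exists t => //; apply: val_inj; rewrite wE.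
by elim: t {wE} => [|i t IHt]; rewrite ?big_nil // !big_cons IHt.
Qed.

Lemma cox_word w : exists t, w = wd t.
Proof.
have : generated (range (cox_refl S)) w by rewrite generated_cox_refl.
by rewrite generated_words; [move=> [t _ ->]; exists t | exact: cox_reflK].
Qed.

(** * Points of the chamber and of its walls *)

Lemma pairing_sup i : exists2 c, chamber S c & 0 < pairing i c.
Proof.
apply: contrapT => nc.
have [_ sp] := lcs_chamber_span S.
(* Otherwise the chamber would lie in the hyperplane of [i] and could not span the dual space. *)
have /subvP/(_ (simple_root i) (memvf _)) : (fullv <= lker (linfun (pairing i)))%VS.
  apply: sp => c cc; rewrite /= memv_ker lfunE /=; apply: contrapT => /negP ci.
  by apply: nc; exists c => //; rewrite lt_def ci /=; move/chamberE: cc.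
by rewrite memv_ker lfunE /= pairing_root pnatr_eq0.
Qed.

Lemma open_chamber_nonempty : exists c, forall i, 0 < pairing i c.
Proof.
pose d i := s2val (cid2 (pairing_sup i)).
have dP i : chamber S (d i) /\ 0 < pairing i (d i) by rewrite /d; case: cid2.
exists (\sum_i d i) => i; rewrite linear_sum (bigD1 i) //= ltr_pwDl ?(dP i).2 //.
by apply: sumr_ge0 => k _; exact: (chamberE _).1 (dP k).1 i.
Qed.

Lemma open_chamber_disj w c :
  (forall i, 0 < pairing i c) -> (forall i, 0 < pairing i (w c)) -> w = 1%g.
Proof.
move=> cc wc; apply: contrapT => w1.
have w1' : val w <> 1%g by move=> vw; apply: w1; apply: val_inj.
have := lcs_chamber_disj (set_mem (valP w)) w1'; rewrite -subset0; apply.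
by split; [exists c => //; exact/open_chamberE | exact/open_chamberE].
Qed.

Lemma proportional_pairing j (f : {linear dual -> R^o}) :
  (forall x, pairing j x = 0 -> f x = 0) ->
  forall x, f x = pairing j x * (f (simple_root j) / 2) :> R.
Proof.
move=> jf x; pose a : R := pairing j x / 2.
have {1}-> : x = (x - a *: simple_root j) + a *: simple_root j by rewrite subrK.
rewrite linearD jf; last first.
  by rewrite linearB /= pairingZ pairing_root /a divfK ?subrr.
by rewrite add0r linearZ /= /a -[_ *: _]/(_ * _) mulrAC mulrA.
Qed.

(** A wall has codimension 1 in a chamber spanning the whole space, so its span is the full kernel
    of [pairing j]. *)
Lemma wall_span j k :
  (forall x, wall (lcs_H S) j x -> pairing k x = 0) ->
  forall x, pairing j x = 0 -> pairing k x = 0.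
Proof.
move=> jk x xj; pose ker l := lker (linfun (pairing l)).
have kerE l y : (y \in ker l) = (pairing l y == 0) by rewrite memv_ker lfunE.
have : range (wall (lcs_H S)) (wall (lcs_H S) j) by exists j.
rewrite -lcs_walls => -[_ [U [U' [[subU _] [_ minU'] dimU]]]].
have Ufull : (fullv <= U)%VS := (lcs_chamber_span S).2 U subU.
have Uj : (U' <= ker j)%VS.
  by apply: minU' => y /wallE[_ yj]; rewrite /= kerE yj.
have Uk : (U' <= ker k)%VS by apply: minU' => y /jk yk; rewrite /= kerE yk.
have jproper : ~~ (fullv <= ker j)%VS.
  apply/negP => /subvP/(_ (simple_root j) (memvf _)).
  by rewrite kerE pairing_root pnatr_eq0.
have U'E : U' = ker j.
  apply/eqP; rewrite eqEdim Uj leqNgt; apply: contra jproper => dimj.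
  suff -> : ker j = fullv by [].
  apply/eqP; rewrite eqEdim subvf (leq_trans (dimvS Ufull)) //.
  by rewrite -dimU.
by move: (subvP Uk x); rewrite U'E !kerE xj eqxx => /(_ isT)/eqP.
Qed.

(** For each [k] other than [j] some point of wall [j] is positive at [k], and the sum of such
    points works. If [pairing k] vanished on wall [j], it would be a positive multiple of
    [pairing j], and the walls [j] and [k] would coincide. *)
Lemma wall_point j :
  exists2 p, pairing j p = 0 & forall k, k != j -> 0 < pairing k p.
Proof.
have ex k : exists d, k != j -> wall (lcs_H S) j d /\ 0 < pairing k d.
  have [_|kj] := eqVneq k j; first by exists 0.
  apply: contrapT => nd; move/eqP: kj; apply.
  have jk : forall x, pairing j x = 0 -> pairing k x = 0.
    apply: wall_span => x xj; apply: contrapT => /eqP xk; apply: nd; exists x => _.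
    by split=> //; rewrite lt_def xk /=; case/wallE: xj => /chamberE.
  have kE := proportional_pairing jk; set a : R := _ / 2 in kE.
  have [c cc] := open_chamber_nonempty.
  have a0 : 0 < a by have := cc k; rewrite kE pmulr_rgt0.
  apply: (@lcs_walls_inj _ _ _ S); apply/seteqP; split=> x /wallE[xc x0].
    by apply/wallE; split=> //; apply/eqP; have/eqP := x0; rewrite kE mulf_eq0 (gt_eqF a0) orbF.
  by apply/wallE; split=> //; rewrite kE x0 mul0r.
pose d k := sval (cid (ex k)).
have dP k : k != j -> wall (lcs_H S) j (d k) /\ 0 < pairing k (d k).
  by rewrite /d; case: cid.
exists (\sum_(k | k != j) d k) => [|k kj]; rewrite linear_sum /=.
  by rewrite big1 // => k /dP[/wallE[]].
rewrite (bigD1 k) //= ltr_pwDl ?(dP _ kj).2 //.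
by apply: sumr_ge0 => l /andP[/dP[/wallE[/chamberE]]].
Qed.

(** * Chambers on either side of a hyperplane *)

Definition positive w i := forall c, (forall k, 0 < pairing k c) -> 0 < pairing i (w c).
Definition negative w i := forall c, (forall k, 0 < pairing k c) -> pairing i (w c) < 0.

Lemma pairing_neq0 w i c : (forall k, 0 < pairing k c) -> pairing i (w c) != 0.
Proof.
move=> cc; apply/eqP => /refl_fixed wc.
have : (w^-1 * cox_refl S i * w)%g = 1%g.
  by apply: (open_chamber_disj cc) => k; rewrite 2!coxME wc coxVK.
move=> /(congr1 (fun v => w * v * w^-1)%g); rewrite mulg1 mulgV !mulgA mulgV mul1g mulgK.
exact: cox_refl_neq1.
Qed.

(* A chamber [w C] on which [pairing i] changed sign would meet its kernel, and
   [w^-1 s_i w] would fix a point of [C]. *)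
Lemma positive_or_negative w i : positive w i \/ negative w i.
Proof.
have [pos|/existsNP[c /not_implyP[cc /negP]]] := pselect (positive w i); first by left.
rewrite -leNgt => ci; right => d dd; rewrite ltNge; apply/negP => di.
have [c0|c0] := eqVneq (pairing i (w c)) 0; first by have := pairing_neq0 w i cc; rewrite c0 eqxx.
have {}ci : 0 < - pairing i (w c) by rewrite oppr_gt0 lt_def eq_sym c0.
pose e : dual := (pairing i (w d) : R) *: c + (- pairing i (w c) : R) *: d.
have : pairing i (w e) = 0.
  by rewrite /e coxD !coxZ linearD /= !pairingZ mulrC mulNr subrr.
apply/eqP/pairing_neq0 => k; rewrite /e linearD /= !pairingZ.
by rewrite ltr_wpDl ?mulr_gt0 ?mulr_ge0 // ltW.
Qed.

(** Passage to the closure: adding to [c] a small multiple of a point of the open chamber gives a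
    point of the open chamber, and would keep a negative value negative. *)
Lemma positive_ge0 w i c : positive w i -> chamber S c -> 0 <= pairing i (w c).
Proof.
move=> pos /chamberE cc; have [d dd] := open_chamber_nonempty.
rewrite leNgt; apply/negP => ci.
have [e e0 /(_ tt erefl)] := @small_perturbation R unit predT
  (fun=> - pairing i (w c)) (fun=> - pairing i (w d)) (fun _ _ => etrans (oppr_gt0 _) ci).
rewrite mulrN -opprD oppr_gt0 -pairingZ -linearD -coxZ -coxD ltNge.
move=> /negP; apply; apply/ltW/pos => k.
by rewrite linearD /= pairingZ ltr_wpDl ?cc // mulr_gt0.
Qed.

Lemma negative_refl w i : positive w i -> negative (cox_refl S i * w)%g i.
Proof. by move=> pos c cc; rewrite coxME pairing_refl oppr_lt0 pos. Qed.

Lemma positive_refl w i : negative w i -> positive (cox_refl S i * w)%g i.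
Proof. by move=> neg c cc; rewrite coxME pairing_refl oppr_gt0 neg. Qed.

Lemma not_positive_negative w i : positive w i -> negative w i -> False.
Proof.
have [c cc] := open_chamber_nonempty.
by move=> pos neg; have := lt_trans (pos c cc) (neg c cc); rewrite ltxx.
Qed.

(* The hyperplane of [u^-1 s_i u] separates [C] from the adjacent chamber
   [s_j C], hence is the hyperplane of [s_j]; the product of the two reflections
   then maps points of [C] close to the wall [j] into [C]. *)
Lemma refl_crossing u i j : positive u i -> negative (u * cox_refl S j)%g i ->
  (cox_refl S i * u)%g = (u * cox_refl S j)%g.
Proof.
move=> pos neg; have [p pj pk] := wall_point j.
have p_ge0 k : 0 <= pairing k p.
  by have [->|/pk/ltW//] := eqVneq k j; rewrite pj.
have neg' : positive (cox_refl S i * u * cox_refl S j)%g i.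
  by move=> c cc; rewrite -mulgA coxME pairing_refl oppr_gt0 neg.
(* The reflection [j] fixes [p], so [pos] and [neg'] bound this value from both sides. *)
have up : pairing i (u p) = 0.
  apply/eqP; rewrite eq_le (positive_ge0 pos) ?andbT; last by apply/chamberE.
  have := positive_ge0 neg' ((chamberE p).2 p_ge0).
  by rewrite !coxME pairing_refl ((refl_fixed _ _).2 pj) oppr_ge0.
pose f x : R^o := pairing i (u x).
have f_linear : linear f by move=> a x y; rewrite /f coxD coxZ linearP.
pose fL := GRing.isLinear.Build R dual R^o _ f f_linear.
pose F : {linear dual -> R^o} := HB.pack f fL.
have jF x : pairing j x = 0 -> F x = 0.
  (* Within the hyperplane of [j], small moves away from [p] stay in the closed chamber; using both
     [x] and [- x] forces equality. *)
  have half y : pairing j y = 0 -> 0 <= f y.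
    move=> yj; have [e e0 eP] := small_perturbation (fun k => pairing k y) pk.
    rewrite -(pmulr_rge0 _ e0) /f -pairingZ -coxZ -[leRHS]add0r -up -linearD -coxD.
    rewrite up /=; apply: positive_ge0 => //; apply/chamberE => k; rewrite linearD /= pairingZ.
    by have [->|/eP/ltW//] := eqVneq k j; rewrite pj yj mulr0 addr0.
  move=> xj; apply/eqP; rewrite eq_le; apply/andP; split; last exact: half.
  by rewrite -oppr_ge0 -linearN half // linearN /= xj oppr0.
have fE x : f x = pairing j x * (f (simple_root j) / 2) := proportional_pairing jF x.
have f0 : 0 < f (simple_root j) / 2.
  have [c cc] := open_chamber_nonempty.
  by have := pos c cc; rewrite -/(f c) fE pmulr_rgt0.
pose r : W := (u^-1 * cox_refl S i * u * cox_refl S j)%g.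
suff r1 : r = 1%g.
  have : (u * r * cox_refl S j)%g = (u * cox_refl S j)%g by rewrite r1 mulg1.
  by rewrite /r !mulgA mulgV mul1g -(mulgA _ (cox_refl S j) (cox_refl S j)) cox_reflK mulg1.
have rp : r p = p.
  by rewrite /r !coxME ((refl_fixed _ _).2 pj) ((refl_fixed _ _).2 up) coxVK.
(* The reflections [i] and [j] each change the sign of [f] at the root, and [f] is a positive
   multiple of [pairing j]. *)
have rj : 0 < pairing j (r (simple_root j)).
  rewrite -(pmulr_lgt0 _ f0) -fE /f /r !coxME coxKV pairing_refl.
  rewrite cox_reflE pairing_root -{1}[simple_root j]scale1r -scalerBl.
  rewrite coxZ pairingZ -/(f _) -mulNr mulr_gt0 //.
  by rewrite -(pmulr_lgt0 _ (_ : 0 < 2^-1 :> R)) ?invr_gt0.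
have [e1 e10 e1P] := small_perturbation (fun k => pairing k (simple_root j)) pk.
have [e2 e20 e2P] := small_perturbation (fun k => pairing k (r (simple_root j))) pk.
have small (e e' : R) k (y : dual) : k != j -> 0 < e -> e <= e' ->
    0 < pairing k p + e' * pairing k y -> 0 < pairing k (p + e *: y).
  move=> /pk kp e0 ee'; rewrite linearD /= pairingZ => H.
  have [y0|y0] := leP 0 (pairing k y); first by rewrite ltr_wpDr // mulr_ge0 // ltW.
  by apply: lt_le_trans H _; rewrite lerD2l ler_nM2r.
(* For this [e], both [p + e *: simple_root j] and its image under [r] lie in the open chamber,
   which forces [r = 1]. *)
pose e := Num.min e1 e2.
have e0 : 0 < e by rewrite lt_min e10.
apply: (@open_chamber_disj _ (p + e *: simple_root j)) => k.
  have [->|kj] := eqVneq k j.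
    by rewrite linearD /= pairingZ pj add0r pairing_root mulr_gt0.
  by apply: (small e e1) => //; [rewrite ge_min lexx|exact: e1P].
rewrite coxD coxZ rp; have [->|kj] := eqVneq k j.
  by rewrite linearD /= pairingZ pj add0r mulr_gt0.
by apply: (small e e2) => //; [rewrite ge_min lexx orbT|exact: e2P].
Qed.

(** Walk along the gallery: [u] collects the letters already read, and the first letter leading to
    the negative side is the one to delete. *)
Lemma exchange_negative u i t : positive u i -> negative (u * wd t)%g i ->
  exists t1 j t2, t = t1 ++ j :: t2 /\ (cox_refl S i * (u * wd t) = u * wd (t1 ++ t2))%g.
Proof.
elim: t u => [|j t IHt] u pos.
  by rewrite big_nil mulg1 => /(not_positive_negative pos).
rewrite big_cons mulgA; have [pos'|neg' _] := positive_or_negative (u * cox_refl S j)%g i.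
  move=> /(IHt _ pos')[t1 [k [t2 [-> E]]]]; exists (j :: t1), k, t2; split=> //.
  by rewrite E /= big_cons mulgA.
exists [::], j, t; split=> //=.
by rewrite mulgA -(refl_crossing pos neg') -!mulgA mulgA cox_reflK mul1g.
Qed.

Lemma exchange_word i t : negative (wd t) i ->
  exists t1 j t2, t = t1 ++ j :: t2 /\ (cox_refl S i * wd t = wd (t1 ++ t2))%g.
Proof.
move=> neg; have pos1 : positive 1%g i by move=> c cc; rewrite cox1E.
have [|t1 [j [t2 [tE E]]]] := @exchange_negative 1%g i t pos1; first by rewrite mul1g.
by exists t1, j, t2; split=> //; move: E; rewrite !mul1g.
Qed.

Lemma exchange_cox : exchange (cox_refl S).
Proof.
move=> i t tr itr; have [pos|/exchange_word//] := positive_or_negative (wd t) i.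
(* On the positive side [i :: t] is reduced: any word [u] with its product loses a letter to become
   a word for the product of [t]. *)
exfalso; apply: itr => u uE.
have : negative (wd u) i by rewrite uE big_cons; apply: negative_refl.
move=> /exchange_word[t1 [j [t2 [uE' iu]]]].
have := tr (t1 ++ t2); rewrite -iu uE big_cons mulgA cox_reflK mul1g => /(_ erefl).
by rewrite uE' !size_cat /= addnS ltnS.
Qed.

(* Stands for induction on the length of the group element moving [z] into the
   chamber. *)
Lemma tits_ind (J : set 'I_n) (P : dual -> Prop) :
  (forall z, (forall i, J i -> 0 <= pairing i z) -> P z) ->
  (forall i z, J i -> pairing i z < 0 -> P (cox_refl S i z) -> P z) ->
  forall z, tits_cone S z -> P z.
Proof.
move=> P0 Pr z [w _ [c cc <-]]; have [t ->] := cox_word w.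
have [k] := ubnP (size t); elim: k t => // k IHk t tk.
have [/P0//|/existsNP[i /not_implyP[Ji /negP]]] :=
  pselect (forall i, J i -> 0 <= pairing i (cox_fun (wd t) c)).
rewrite -ltNge => ti; apply: (Pr i) => //; rewrite -coxME.
have [pos|/exchange_word[t1 [j [t2 [tE ->]]]]] := positive_or_negative (wd t) i.
  by have := positive_ge0 pos cc; rewrite leNgt ti.
by apply: IHk; move: tk; rewrite tE !size_cat /= addnS ltnS.
Qed.

Lemma tits_chamber_ind (P : dual -> Prop) :
  (forall c, chamber S c -> P c) ->
  (forall i z, pairing i z < 0 -> P (cox_refl S i z) -> P z) ->
  forall z, tits_cone S z -> P z.
Proof.
move=> Pc Pr; apply: (@tits_ind setT) => [z z0|i z _]; last exact: Pr.
by apply/Pc/chamberE => i; apply: z0.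
Qed.

(** Induction on the length of a word for [w]. If the image chamber lies on the positive side of the
    first letter [i], the word can be shortened; otherwise the point reached before applying [i] has
    [pairing i] both nonnegative and nonpositive, so [i] fixes it. *)
Lemma chamber_fundamental w c : chamber S c -> chamber S (w c) ->
  w c = c /\ exists2 t, {in t, forall i, pairing i c = 0} & w = wd t.
Proof.
move=> cc; have [t ->] := cox_word w.
have [k] := ubnP (size t); elim: k t => // k IHk [|i t] tk.
  by rewrite big_nil cox1E => _; split=> //; exists [::]; rewrite ?big_nil.
have [pos|neg] := positive_or_negative (wd (i :: t)) i.
  have : negative (wd t) i.
    by have := negative_refl pos; rewrite big_cons mulgA cox_reflK mul1g.
  move=> /exchange_word[t1 [j [t2 [tE E]]]]; rewrite big_cons E; apply: IHk.
  by move: tk; rewrite tE /= !size_cat /= addnS ltnS => /ltnW.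
rewrite big_cons coxME => wc.
have wc' : chamber S (cox_fun (wd t) c) -> _ := IHk _ tk.
have i0 : pairing i (cox_fun (wd t) c) = 0.
  apply/eqP; rewrite eq_le; apply/andP; split.
    rewrite -oppr_ge0 -pairing_refl.
    by have /chamberE := wc.
  apply: positive_ge0 cc; have := positive_refl neg.
  by rewrite big_cons mulgA cox_reflK mul1g.
have /refl_fixed E := i0; rewrite E in wc *.
have [tc [u uc uE]] := wc' wc; rewrite tc in i0 *; split=> //.
exists (i :: u); last by rewrite big_cons uE.
by move=> l; rewrite inE => /predU1P[->|/uc].
Qed.

End Geometry.

(** * Relative interiors of convex cones *)

Section Cones.
Local Open Scope ring_scope.
Variables (R : realType) (V : vectType R).
Implicit Types (K F T : set V) (x y z : V) (b : seq V).

Local Notation coords := (passmx.rVof (vbasis {:V})).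

Lemma coordsZ (t : R) z : coords (t *: z) = t *: coords z.
Proof. by apply/rowP => i; rewrite !mxE linearZ. Qed.

Lemma linear_form_bounded (f : {linear V -> R^o}) :
  exists2 M : R, 0 <= M & forall z, `|f z : R| <= M * `|coords z|.
Proof.
exists (\sum_(k < \dim {:V}) `|f (vbasis {:V})`_k : R|) => [|z].
  by apply: sumr_ge0 => k _; apply: normr_ge0.
rewrite {1}(coord_vbasis (memvf z)) linear_sum (le_trans (ler_norm_sum _ _ _)) //.
rewrite mulr_suml ler_sum // => k _; rewrite linearZ /= -[_ *: _]/(_ * _) normrM mulrC.
rewrite ler_wpM2l // passmx.coord_rVof [leRHS]/Num.norm /= mx_normrE.
by apply/bigmax_geP; right => /=; exists (ord0, k).
Qed.

Lemma cone_scale0 K (t : R) x : convex_cone K -> K 0 -> 0 <= t -> K x -> K (t *: x).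
Proof.
move=> [_ KZ] K0; rewrite le_eqVlt => /predU1P[<- _|t0]; first by rewrite scale0r.
exact: KZ.
Qed.

Lemma cone_sum K (I : Type) (r : seq I) (p : I -> V) :
  convex_cone K -> K 0 -> (forall i, K (p i)) -> K (\sum_(i <- r) p i).
Proof. by move=> [KD _] K0 Kp; elim/big_ind: _ => // x y; exact: KD. Qed.

(** A free sequence in [K] of maximal length spans all of [K]. *)
Lemma spanning_seq K :
  exists b, {in b, forall y, K y} /\ K `<=` [set x | x \in <<b>>%VS].
Proof.
pose P k := `[< exists b, [/\ free b, size b = k & {in b, forall y, K y}] >].
have P0 : exists k, P k by exists 0%N; apply/asboolP; exists [::]; rewrite nil_free.
have Pmax k : P k -> (k <= \dim {:V})%N.
  by move=> /asboolP[b [/eqP <- <- _]]; rewrite dimvS // subvf.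
have [k /asboolP[b [fb sb Kb]] kmax] := ex_maxnP P0 Pmax.
exists b; split=> // y Ky /=; apply: contrapT => /negP yb.
have : P k.+1.
  apply/asboolP; exists (y :: b); split; first by rewrite free_cons yb.
    by rewrite /= sb.
  by move=> z; rewrite inE => /predU1P[->|/Kb].
by move=> /kmax; rewrite ltnn.
Qed.

(** An algebraic form of the relative interior of a convex cone containing 0, identified with
    [relint] in [relint_core]; it avoids the norm in the arguments on faces. *)
Definition core K : set V :=
  [set x | K x /\ forall y, K y -> exists2 e : R, 0 < e & K (x - e *: y)].

Lemma core_nonempty K : convex_cone K -> K 0 -> core K !=set0.
Proof.
move=> cK K0; have [b [Kb bK]] := spanning_seq K.
have Kbi (i : 'I_(size b)) : K b`_i by apply: Kb; rewrite mem_nth.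
exists (\sum_(i < size b) b`_i); split=> [|y Ky]; first exact: cone_sum.
pose c i := coord (in_tuple b) i y.
have [e e0 eP] := @small_perturbation R _ predT (fun=> 1) (fun i => - c i) (fun _ _ => ltr01).
exists e => //; rewrite {1}(coord_span (X := in_tuple b) (bK _ Ky)) scaler_sumr -sumrB.
apply: cone_sum => // i; rewrite scalerA -{1}[_`_i]scale1r -scalerBl.
by apply: cone_scale0 => //; rewrite -mulrN ltW ?eP.
Qed.

Lemma relint_core K : convex_cone K -> K 0 -> relint K = core K.
Proof.
move=> cK K0; have [KD KZ] := cK; apply/seteqP; split=> x.
  move=> [xA [e e0 eK]].
  have Kx : K x.
    by apply: eK => //; rewrite subrr -(scale0r x) coordsZ scale0r normr0.
  split=> //.
  move=> y Ky; pose m := `|coords (x - y)|.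
  have m1 : 0 < 1 + m by rewrite ltr_pwDl // normr_ge0.
  (* Small enough that prolonging the segment from [y] to [x] beyond [x] by the factor [t] stays in
     the [e]-ball; rescaling the endpoint gives the required difference. *)
  pose t := e / (1 + m); have t0 : 0 < t by rewrite divr_gt0.
  have Kt : K (x + t *: (x - y)).
    apply: eK.
      exists 2%N, (fun i : 'I_2 => if i == ord0 then 1 + t else - t),
        (fun i : 'I_2 => if i == ord0 then x else y); split.
      - by move=> i; case: ifP.
      - by rewrite !big_ord_recl big_ord0 /= addr0 addrK.
      - rewrite !big_ord_recl big_ord0 /= addr0 scalerDl scale1r scaleNr -addrA.
        by rewrite scalerBr.
    rewrite addrC addKr coordsZ mx_normZ gtr0_norm // -/m /t mulrAC ltr_pdivrMr //.
    by rewrite ltr_pM2l // ltrDr.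
  have t1 : 0 < 1 + t by rewrite addr_gt0.
  exists (t / (1 + t)); first by rewrite divr_gt0.
  have -> : x - (t / (1 + t)) *: y = (1 + t)^-1 *: (x + t *: (x - y)).
    rewrite scalerBr addrA -{2}[x]scale1r -scalerDl scalerBr !scalerA mulVf ?gt_eqF //.
    by rewrite scale1r (mulrC t).
  by apply: KZ => //; rewrite invr_gt0.
move=> [Kx xcore]; split.
  exists 1%N, (fun=> 1), (fun=> x); split=> //; first by rewrite big_ord_recl big_ord0 addr0.
  by rewrite big_ord_recl big_ord0 addr0 scale1r.
have [b [Kb bK]] := spanning_seq K.
have Kbi (i : 'I_(size b)) : K b`_i by apply: Kb; rewrite mem_nth.
have [|e e0 Ke] := xcore (\sum_(i < size b) b`_i); first exact: cone_sum.
pose M i := s2val (cid2 (linear_form_bounded (coord (in_tuple b) i))).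
have MP i : 0 <= M i /\ forall z, `|coord (in_tuple b) i z : R| <= M i * `|coords z|.
  by rewrite /M; case: cid2.
have M1 : 0 < 1 + \sum_i M i by rewrite ltr_pwDl // sumr_ge0 // => i _; case: (MP i).
exists (e / (1 + \sum_i M i)) => [|y [m [a [p [Kp _ yE]]]] ye]; first by rewrite divr_gt0.
have yb : y - x \in <<b>>%VS.
  rewrite rpredB ?(bK _ Kx) // yE; apply: rpred_sum => i _.
  by rewrite rpredZ // (bK _ (Kp i)).
(* The radius makes every coordinate of [y - x] at least [- e], so the second sum has nonnegative
   coefficients. *)
have -> : y = (x - e *: \sum_(i < size b) b`_i) +
    \sum_(i < size b) (e + coord (in_tuple b) i (y - x)) *: b`_i.
  under [X in _ + X]eq_bigr do rewrite scalerDl.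
  rewrite big_split /= -scaler_sumr addrA subrK -(coord_span (X := in_tuple b) yb).
  by rewrite addrC subrK.
apply: KD => //; apply: cone_sum => // i; apply: cone_scale0 => //.
rewrite -lerBlDl sub0r; have [M0 /(_ (y - x))] := MP i.
rewrite ler_norml => /andP[+ _]; apply: le_trans; rewrite lerN2.
move: ye; rewrite ltr_pdivlMr // => /ltW; apply: le_trans.
rewrite mulrC ler_wpM2l // (bigD1 i) //= addrCA lerDl addr_ge0 // sumr_ge0 // => j _.
by case: (MP j).
Qed.

Lemma core_pos K (s t : R) x y : convex_cone K -> K 0 -> 0 < t -> 0 <= s ->
  core K x -> K y -> core K (t *: x + s *: y).
Proof.
move=> cK K0 t0 s0 [Kx xc] Ky; have [KD KZ] := cK; have Ksy := cone_scale0 cK K0 s0 Ky.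
split=> [|z Kz]; first by apply: KD => //; exact: KZ.
have [e e0 Ke] := xc _ Kz; exists (t * e); first exact: mulr_gt0.
by rewrite addrAC -scalerA -scalerBr; apply: KD => //; exact: KZ.
Qed.

(** Write [x] as [(x - e *: y) + e *: y] inside [F]; as the sum lies in the face [T], so does
    [y]. *)
Lemma core_face_sub K F T x : convex_cone K -> is_face K T -> F `<=` K ->
  core F x -> T x -> F `<=` T.
Proof.
move=> [_ KZ] [[_ TZ] TK Tmax] FK [_ xc] Tx y Fy; have [e e0 Fe] := xc _ Fy.
apply: contrapT => nTy; have nTey : ~ T (e *: y).
  move=> /(TZ e^-1); rewrite invr_gt0 e0 scalerA mulVf ?gt_eqF // scale1r => /(_ isT).
  exact: nTy.
have [_] := Tmax _ _ (conj (KZ _ _ e0 (FK _ Fy)) nTey) (FK _ Fe).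
by rewrite addrC subrK.
Qed.

End Cones.

(** * Faces meeting the chamber *)

Section Faces.
Local Open Scope ring_scope.
Variables (R : realType) (h : vectType R) (n : nat) (S : linear_coxeter_system h n).
Variable Y : invariant_subcone S.
Local Notation dual := ('Hom(h, R^o)).
Local Notation W := (cox_group S).
Local Notation wd t := (\prod_(i <- t) cox_refl S i)%g.
Implicit Types (i j k : 'I_n) (x y z c : dual) (w v u : W) (t : seq 'I_n) (F T : face Y).

Lemma face_sub F : F `<=` Y.
Proof. by have [[]] := faceP F. Qed.

Lemma face_cone F : convex_cone F.
Proof. by have [[]] := faceP F. Qed.

Lemma face_tits F z : face_set F z -> tits_cone S z.
Proof. by move=> /face_sub; exact: isc_sub. Qed.

Lemma core_face_le F T x : core F x -> face_set T x -> F `<=` T.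
Proof.
by apply: core_face_sub (isc_cone Y) (faceP T).1 (@face_sub F).
Qed.

Lemma core_face_eq F T x : core F x -> core T x -> F = T.
Proof.
move=> Fx Tx; apply: face_eqP; apply/seteqP; split.
  by apply: core_face_le Fx Tx.1.
by apply: core_face_le Tx Fx.1.
Qed.

Lemma core_preim w F x : core F (w x) <-> core (face_preim w F) x.
Proof.
split=> -[Fx xc]; split=> // y.
  rewrite face_preimE => /xc[e e0 Fe]; exists e => //.
  by rewrite face_preimE coxD -scaleNr coxZ scaleNr.
move=> Fy; have [|e e0] := xc (cox_fun w^-1%g y); first by rewrite face_preimE coxKV.
by rewrite face_preimE coxD -scaleNr coxZ scaleNr coxKV; exists e.
Qed.

Lemma face_preim1 F : face_preim 1%g F = F.
Proof. by apply: face_eqP; apply/seteqP; split=> x /=; rewrite face_preimE cox1E. Qed.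

Lemma face_preimM u v F : face_preim (u * v)%g F = face_preim v (face_preim u F).
Proof. by apply: face_eqP; apply/seteqP; split=> x /=; rewrite !face_preimE coxME. Qed.

Lemma face_preim_fixed w F x : core F x -> w x = x -> face_preim w F = F.
Proof. by move=> Fx wx; apply: (core_face_eq (x := x)) => //; apply/core_preim; rewrite wx. Qed.

Lemma face_preim_word t F :
  {in t, forall i, face_preim (cox_refl S i) F = F} -> face_preim (wd t) F = F.
Proof.
elim: t => [|i t IHt] tF; first by rewrite big_nil face_preim1.
rewrite big_cons face_preimM tF ?mem_head // IHt // => k kt.
by apply: tF; rewrite inE kt orbT.
Qed.

Lemma ups_typeE F i : ups_type F i <-> face_preim (cox_refl S i) F = F.
Proof.
have sK x : cox_refl S i (cox_refl S i x) = x by rewrite -coxME cox_reflK cox1E.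
split=> [FE|FE].
  apply: face_eqP; apply/seteqP; split=> x /=.
    by rewrite face_preimE => Fx; rewrite -FE; exists (cox_refl S i x).
  by move=> Fx; rewrite face_preimE -FE; exists x.
apply/seteqP; split=> [_ [x Fx <-]|x Fx]; first by rewrite -face_preimE FE.
by exists (cox_refl S i x) => //; rewrite -face_preimE FE.
Qed.

Lemma upsE F : ups Y F <-> exists2 c, core F c & chamber S c.
Proof.
rewrite /ups /= (relint_core (face_cone F) (face0 F)).
by split=> [[c [Fc cc]]|[c Fc cc]]; exists c.
Qed.

(* The segment from [z] to a core point of [F] in the chamber meets the kernel
   of [pairing i] in a core point of [F], which is fixed by the reflection. *)
Lemma ups_refl F i z : ups Y F -> face_set F z -> pairing S i z < 0 ->
  face_preim (cox_refl S i) F = F.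
Proof.
move=> /upsE[c Fc /chamberE cc] Fz zi.
have q : core F ((- pairing S i z : R) *: c + (pairing S i c : R) *: z).
  by apply: core_pos => //; [exact: face_cone|exact: face0|rewrite oppr_gt0].
apply: face_preim_fixed q _; apply/refl_fixed.
by rewrite linearD /= !pairingZ mulrC mulrN addNr.
Qed.

(** This criterion no longer mentions a point of the chamber, so it passes to intersections. For the
    converse, a core point of [F] is reflected into the chamber, and every reflection used
    stabilizes [F]. *)
Lemma upsP F : ups Y F <->
  forall i z, face_set F z -> pairing S i z < 0 -> face_preim (cox_refl S i) F = F.
Proof.
split=> [uF i z|FP]; first exact: ups_refl.
have [z Fz] := core_nonempty (face_cone F) (face0 F).
have Xz := face_tits Fz.1; apply/upsE; move: z Xz Fz.
apply: tits_chamber_ind => [c cc Fc|i z zi IH Fz].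
  by exists c.
by apply: IH; apply/core_preim; rewrite (FP i z Fz.1).
Qed.

Lemma ups_into_chamber F z : ups Y F -> face_set F z ->
  exists2 t, {in t, forall i, face_preim (cox_refl S i) F = F} &
             chamber S (cox_fun (wd t) z).
Proof.
move=> uF Fz; have Xz := face_tits Fz; move: z Xz Fz.
apply: tits_chamber_ind => [c cc Fc|i z zi IH Fz].
  by exists [::] => //; rewrite big_nil cox1E.
have iF := ups_refl uF Fz zi.
have [|t tF tz] := IH; first by rewrite -face_preimE iF.
exists (rcons t i) => [k|]; first by rewrite mem_rcons inE => /predU1P[->|/tF].
by rewrite -cats1 big_cat big_seq1 coxME.
Qed.

Lemma ups_meet F T : ups Y F -> ups Y T -> ups Y (face_meet F T).
Proof.
move=> uF uT; apply/upsP => i z [Fz Tz] zi.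
apply: face_eqP; rewrite -[in RHS](ups_refl uF Fz zi) -[in RHS](ups_refl uT Tz zi).
by apply/seteqP; split.
Qed.

Lemma ups_preim_ex F : exists w, ups Y (face_preim w F).
Proof.
have [z Fz] := core_nonempty (face_cone F) (face0 F).
have [w _ [c cc wc]] := face_tits Fz.1.
by exists w; apply/upsE; exists c => //; apply/core_preim; rewrite wc.
Qed.

(** Uniqueness in the cross section: the stabilizer of [T] moves [w c] back into the chamber, where
    it must equal [c]; thus [F] and [T] share a core point. *)
Lemma ups_preim_eq w F T : ups Y F -> ups Y T -> F = face_preim w T -> F = T.
Proof.
move=> /upsE[c Fc cc] uT FE.
have Twc : core T (w c) by apply/core_preim; rewrite -FE.
have [t tT tc] := ups_into_chamber uT Twc.1.
have [|tcE _] := @chamber_fundamental _ _ _ S (wd t * w)%g c cc; first by rewrite coxME.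
apply: (core_face_eq Fc).
by rewrite -tcE coxME; apply/core_preim; rewrite face_preim_word.
Qed.

(** First [T] is brought into [ups Y]; then a core point of the smaller face is moved into the
    chamber by reflections that stabilize the larger one. *)
Lemma ups_preim_pair F T : F `<=` T ->
  exists w, ups Y (face_preim w F) /\ ups Y (face_preim w T).
Proof.
move=> FT; have [w uT] := ups_preim_ex T.
have [z Fz] := core_nonempty (face_cone (face_preim w F)) (face0 _).
have [|t tT tc] := ups_into_chamber uT (z := z); first by apply: FT; exact: Fz.1.
have uTE : face_preim (wd t)^-1%g (face_preim w T) = face_preim w T.
  by rewrite -[in LHS](face_preim_word tT) -face_preimM mulgV face_preim1.
exists (w * (wd t)^-1)%g; rewrite !face_preimM uTE; split=> //.
apply/upsE; exists (cox_fun (wd t) z) => //.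
by apply: (core_preim _ _ _).1; rewrite coxVK.
Qed.

(** After [w c] is moved back into the chamber by reflections stabilizing [F], the remaining element
    is a product of reflections fixing the core point [c], and these stabilize [F] too. *)
Lemma ups_stabilizer_word w F : ups Y F -> face_preim w F = F ->
  exists2 t, {in t, forall i, ups_type F i} & w = wd t.
Proof.
move=> uF wF; have /upsE[c Fc cc] := uF.
have Fwc : face_set F (w c) by rewrite -face_preimE wF; exact: Fc.1.
have [t tF tc] := ups_into_chamber uF Fwc.
have [|_ [u uc uE]] := @chamber_fundamental _ _ _ S (wd t * w)%g c cc; first by rewrite coxME.
exists (rev t ++ u) => [i|].
  rewrite mem_cat mem_rev => /orP it; apply/ups_typeE; case: it => [/tF//|/uc ic].
  by apply: face_preim_fixed Fc _; apply/refl_fixed.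
rewrite big_cat -uE /= mulgA.
have -> : (wd (rev t) * wd t = 1)%g; last by rewrite mul1g.
elim: t {tF tc uE} => [|i t IHt]; first by rewrite !big_nil mulg1.
by rewrite rev_cons -cats1 big_cat big_seq1 big_cons mulgA -(mulgA _ _ (cox_refl S i)) cox_reflK mulg1.
Qed.

(* [c] is a core point of the part of [F] in the chamber. Reflections fixing [c]
   stabilize [F] and move any [x] in [F] to a point where the pairings vanishing
   at [c] are nonnegative; [c + e *: x] is then in the chamber for small [e]. *)
Lemma ups_generic_point F : ups Y F ->
  exists c, [/\ chamber S c, face_set F c & forall i, pairing S i c = 0 -> ups_lower F i].
Proof.
move=> uF; have /upsE[c0 Fc0 cc0] := uF.
pose D := (F : set dual) `&` chamber S.
have [FD FZ] := face_cone F.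
have cD : convex_cone D.
  split=> [x y [Fx /chamberE xc] [Fy /chamberE yc]|a x a0 [Fx /chamberE xc]].
    by split; [exact: FD|apply/chamberE => i; rewrite linearD addr_ge0 ?xc ?yc].
  by split; [exact: FZ|apply/chamberE => i; rewrite pairingZ mulr_ge0 ?xc ?ltW].
have D0 : D 0 by split; [exact: face0|apply/chamberE => i; rewrite linear0].
have [c [[Fc cc] Dc]] := core_nonempty cD D0.
exists c; split=> // i ci x Fx; apply/refl_fixed.
(* Since [D] contains the core point [c0] of [F], [c] is the sum of a point of [F] and a positive
   multiple of [c0]. *)
have Fcore : core F c.
  have [e e0 [Fe _]] := Dc _ (conj Fc0.1 cc0).
  have -> : c = 1 *: (c - e *: c0) + e *: c0 by rewrite scale1r subrK.
  rewrite addrC scale1r -[X in _ + X]scale1r.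
  by apply: core_pos => //; exact: face0.
have stab k : pairing S k c = 0 -> face_preim (cox_refl S k) F = F.
  by move=> /refl_fixed; exact: face_preim_fixed.
have Xx := face_tits Fx; move: x Xx Fx i ci; apply: (tits_ind (J := fun k => pairing S k c = 0))
    => [x x0 Fx i ci|k x ck xk IH Fx i ci]; last first.
  have Fkx : face_set F (cox_refl S k x) by rewrite -face_preimE stab.
  by have /eqP := IH Fkx k ck; rewrite pairing_refl oppr_eq0 => /eqP xk0; rewrite xk0 ltxx in xk.
have [|e e0 eP] := @small_perturbation R _ [pred k | pairing S k c != 0]
    (fun k => pairing S k c) (fun k => pairing S k x).
  by move=> k /= ck; rewrite lt_def ck /=; move/chamberE: cc.
have Dcx : D (c + e *: x).
  split; first by apply: FD => //; exact: FZ.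
  apply/chamberE => k; rewrite linearD /= pairingZ.
  have [ck|/eP/ltW//] := eqVneq (pairing S k c) 0.
  by rewrite ck add0r mulr_ge0 ?x0 // ltW.
(* As [pairing i c = 0], subtracting a positive multiple of [c + e *: x] stays in the chamber only
   if [pairing i x <= 0]. *)
have [d d0 [_ /chamberE/(_ i)]] := Dc _ Dcx.
rewrite linearB /= pairingZ linearD /= pairingZ ci !add0r oppr_ge0 pmulr_rle0 //.
by rewrite pmulr_rle0 // => xi; apply/eqP; rewrite eq_le xi x0.
Qed.

Lemma ups_fixator_word w F : ups Y F -> (forall x, face_set F x -> w x = x) ->
  exists2 t, {in t, forall i, ups_lower F i} & w = wd t.
Proof.
move=> uF wF; have [c [cc Fc lowF]] := ups_generic_point uF.
have [|_ [t tc ->]] := @chamber_fundamental _ _ _ S w c cc; first by rewrite wF.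
by exists t => // i /tc/lowF.
Qed.

(** A point of [F] moved by reflection [i], or its mirror image in [F], is negative on [i]; it also
    lies in [T], so [ups_refl] applies to [T]. *)
Lemma ups_upper_sub F T : ups Y T -> F `<=` T -> ups_upper F `<=` ups_upper T.
Proof.
move=> uT FT i [/ups_typeE Fi nFi]; split; last first.
  by move=> Ti; apply: nFi => x /FT; exact: Ti.
move: nFi => /existsNP[x /not_implyP[Fx /refl_fixed/eqP xi]]; apply/ups_typeE.
case: (ltgtP (pairing S i x) 0) xi => // xi _; first exact: ups_refl uT (FT _ Fx) xi.
apply: ups_refl uT (FT (cox_refl S i x) _) _; first by rewrite -face_preimE Fi.
by rewrite pairing_refl oppr_lt0.
Qed.

Lemma cox_refl_inj : injective (cox_refl S).
Proof.
move=> i j ij; apply/eqP; apply: contraT; rewrite eq_sym => ji.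
have [p pj pk] := wall_point S j.
have /refl_fixed : cox_refl S i p = p by rewrite ij; apply/refl_fixed.
by have := pk i; rewrite eq_sym ji => /(_ isT)/gt_eqF/eqP.
Qed.

End Faces.

(** * The monoid of an invariant subcone *)

Section FaceMonoidTheory.
Variables (R : realType) (h : vectType R) (n : nat) (S : linear_coxeter_system h n).
Variable Y : invariant_subcone S.
Local Notation M := (face_monoid Y : monoidType).
Local Notation W := (cox_group S).
Local Notation top := (face_top Y).
Implicit Types (i : 'I_n) (w v : W) (t : seq 'I_n) (F T : face Y).

Lemma class_eps_eq w F v T :
  class_eps w F = class_eps v T <-> F = T /\ forall x, face_set F x -> w x = v x.
Proof. by split=> [/class_epsP/sd_simP|wv]; [|apply/class_epsP/sd_simP]. Qed.

Lemma face_preim_top w : face_preim w top = top.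
Proof.
apply: face_eqP; apply/seteqP; split=> x; rewrite face_preimE => Yx; last first.
  by apply: (isc_inv (w := w)); exists x.
by rewrite -(coxVK w x); apply: (isc_inv (w := w^-1)); exists (w x).
Qed.

Lemma face_meetTl F : face_meet top F = F.
Proof. by apply: face_eqP; apply: setIidr; exact: face_sub. Qed.

Lemma face_meetTr F : face_meet F top = F.
Proof. by apply: face_eqP; apply: setIidl; exact: face_sub. Qed.

Lemma face_meetC F T : face_meet F T = face_meet T F.
Proof. by apply: face_eqP; exact: setIC. Qed.

Lemma face_meet_idl F T : face_meet F T = F <-> F `<=` T.
Proof.
split=> [FT x Fx|FT]; last by apply: face_eqP; exact: setIidl.
by have : face_set (face_meet F T) x by [rewrite FT]; case.
Qed.

Lemma epsM F T : (eps F : M) * eps T = eps (face_meet F T).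
Proof. by rewrite /eps class_epsM mulg1 face_preim1. Qed.

Lemma eps_inj : injective (@eps R h n S Y).
Proof. by move=> F T /class_eps_eq[]. Qed.

Lemma class_epsMeps w F T : class_eps w F * eps T = class_eps w (face_meet F T) :> M.
Proof. by rewrite /eps class_epsM mulg1 face_preim1. Qed.

Lemma epsMclass w F : (eps F : M) * class_eps w top = class_eps w (face_preim w F).
Proof. by rewrite /eps class_epsM mul1g face_meetTr. Qed.

Lemma eps_idempotent F : idempotents M (eps F).
Proof. by rewrite /idempotents /= epsM (face_meet_idl _ _).2. Qed.

Lemma idempotentP (e : M) : idempotents M e <-> exists F, e = eps F.
Proof.
split=> [|[F ->]]; last exact: eps_idempotent.
rewrite -(fm_reprK e); move: (fm_repr e).1 (fm_repr e).2 => w F.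
(* Idempotency gives [w (w x) = w x] on [F], and cancelling [w] shows that [w] fixes [F]
   pointwise. *)
rewrite /idempotents /= class_epsM => /class_eps_eq[FE ww].
exists F; apply/class_eps_eq; split=> // x Fx.
have := ww x; rewrite FE coxME => /(_ Fx) wwx; rewrite cox1E.
by rewrite -[LHS](coxVK w) wwx coxVK.
Qed.

Lemma class_top_unit w : units (class_eps w top : M).
Proof.
exists (class_eps w^-1 top).
by rewrite !class_epsM !face_preim_top face_meetTl mulgV mulVg.
Qed.

Definition cox_unit w : unit_group M :=
  exist (fun x => x \in @units M) _ (mem_set (class_top_unit w)).

Fact cox_unit1 : cox_unit 1 = 1.
Proof. exact: val_inj. Qed.
Fact cox_unitM : {morph cox_unit : w v / w * v}.
Proof.
by move=> w v; apply: val_inj; rewrite /= class_epsM face_preim_top face_meetTl.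
Qed.
HB.instance Definition _ :=
  isUMagmaMorphism.Build W (unit_group M) cox_unit (cox_unit1, cox_unitM).

Lemma cox_unit_surj (x : unit_group M) : exists w, x = cox_unit w.
Proof.
have [y [xy yx]] := set_mem (valP x).
suff [w xE] : exists w, val x = class_eps w top by exists w; apply: val_inj.
move: xy yx; rewrite -(fm_reprK (val x)) -(fm_reprK y).
move: (fm_repr (val x)) (fm_repr y) => -[w F] [v T] /=.
rewrite !class_epsM => /class_eps_eq[_ _] /class_eps_eq[FT _].
(* The face of a product is contained in the face of its right factor, so a left inverse forces [F]
   to be all of [Y]. *)
exists w; suff -> : F = top by [].
apply: face_eqP; apply/seteqP; split; first exact: face_sub.
by rewrite -FT => z [].
Qed.

Lemma cox_unit_inj : acts_faithfully Y -> injective cox_unit.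
Proof.
move=> faithful; apply: gmulf_inj => w /(congr1 val)/class_eps_eq[_ w1].
by apply: faithful => y /w1; rewrite cox1E.
Qed.

Lemma conj_eps w F : conj_by (cox_unit w) (eps F : M) = eps (face_preim w^-1 F).
Proof.
by rewrite /conj_by -gmulfV /= class_epsMeps face_meetTl class_epsM mulgV face_meetTr.
Qed.

Lemma commute_eps w F :
  val (cox_unit w) * (eps F : M) = eps F * val (cox_unit w) <-> face_preim w F = F.
Proof.
rewrite /= class_epsMeps face_meetTl epsMclass; split=> [/class_eps_eq[]//|wF].
by rewrite wF.
Qed.

Lemma fix_eps w F :
  (eps F : M) * val (cox_unit w) = eps F <-> forall x, face_set F x -> w x = x.
Proof.
rewrite /= epsMclass; split=> [/class_eps_eq[wF wx] x Fx|wF].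
  by rewrite wx ?cox1E // wF.
have wE : face_preim w F = F.
  apply: face_eqP; apply/seteqP; split=> x; rewrite face_preimE => Fx.
    by have /(congr1 (cox_fun w^-1)) := wF _ Fx; rewrite !coxVK => <-.
  by rewrite wF.
by apply/class_eps_eq; split=> // x; rewrite wE cox1E; exact: wF.
Qed.

Lemma fix_commute w F : (forall x, face_set F x -> w x = x) -> face_preim w F = F.
Proof. by move=> /fix_eps; rewrite /= epsMclass => /class_eps_eq[]. Qed.

Lemma face_monoid_factorisable : factorisable M.
Proof.
split=> [|e f|e f|x|x].
- exact: eps_idempotent.
- by move=> /idempotentP[F ->] /idempotentP[T ->]; rewrite epsM; exact: eps_idempotent.
- by move=> /idempotentP[F ->] /idempotentP[T ->]; rewrite !epsM face_meetC.
- rewrite -(fm_reprK x); move: (fm_repr x).1 (fm_repr x).2 => w F.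
  exists (class_eps w top), (eps F); split; [exact: class_top_unit|exact: eps_idempotent|].
  by rewrite class_epsMeps face_meetTl.
- rewrite -(fm_reprK x); move: (fm_repr x).1 (fm_repr x).2 => w F.
  exists (eps (face_preim w^-1 F)), (class_eps w top).
  split; [exact: eps_idempotent|exact: class_top_unit|].
  by rewrite epsMclass -face_preimM mulVg face_preim1.
Qed.

Definition unit_refl i := cox_unit (cox_refl S i).

Local Notation Sg := (range (gen_class Y)).
Local Notation US := [set x : unit_group M | Sg (val x)].

Lemma unit_refl_range : US = range unit_refl.
Proof.
apply/seteqP; split=> [x [i _ xE]|_ [i _ <-]]; last by exists i.
by exists i => //; apply: val_inj; rewrite -xE.
Qed.

Lemma unit_reflK i : unit_refl i * unit_refl i = 1.
Proof. by rewrite /unit_refl -gmulfM cox_reflK gmulf1. Qed.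

Lemma unit_word t : \prod_(i <- t) unit_refl i = cox_unit (\prod_(i <- t) cox_refl S i).
Proof. by rewrite gmulf_prod. Qed.

Lemma unit_coxeter_system : acts_faithfully Y -> coxeter_system US.
Proof.
move=> /cox_unit_inj inj; rewrite unit_refl_range.
(* Reducedness, and with it the exchange condition, is transported along the injective map
   [cox_unit]. *)
have redE t : reduced unit_refl t <-> reduced (cox_refl S) t.
  split=> tr u tu; apply: tr; first by rewrite !unit_word tu.
  by apply: inj; rewrite -!unit_word.
apply: coxeter_system_exchange.
- exact: unit_reflK.
- by move=> i i1; apply: (@cox_refl_neq1 _ _ _ S i); apply: inj; rewrite gmulf1.
- rewrite generated_words; last exact: unit_reflK.
  apply/seteqP; split=> // x _; have [w ->] := cox_unit_surj x.
  by have [t ->] := cox_word w; exists t => //; rewrite unit_word.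
- move=> i t /redE tr ntr; have [|t1 [j [t2 [tE E]]]] := exchange_cox tr (i := i).
    by move=> /redE.
  by exists t1, j, t2; split=> //; rewrite !unit_word -gmulfM E.
Qed.

Lemma standard_parabolic_words (J : set 'I_n) (P : set (unit_group M)) :
  (forall w, P (cox_unit w) <->
     exists2 t, {in t, forall i, J i} & w = \prod_(i <- t) cox_refl S i) ->
  standard_parabolic US P.
Proof.
move=> PJ; exists (unit_refl @` J).
  by rewrite unit_refl_range => _ [i _ <-]; exists i.
rewrite generated_words; last exact: unit_reflK.
apply/seteqP; split=> [x|_ [t Jt ->]].
  have [w ->] := cox_unit_surj x => /PJ[t Jt ->]; exists t => //.
  by rewrite unit_word.
by rewrite unit_word; apply/PJ; exists t.
Qed.

Lemma cox_word_fix t (A : set 'Hom(h, R^o)) :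
  {in t, forall i x, A x -> cox_refl S i x = x} ->
  forall x, A x -> cox_fun (\prod_(i <- t) cox_refl S i) x = x.
Proof.
elim: t => [|i t IHt] tA x Ax; first by rewrite big_nil cox1E.
rewrite big_cons coxME IHt // => [|k kt]; first by apply: tA; rewrite ?mem_head.
by apply: tA; rewrite inE kt orbT.
Qed.

End FaceMonoidTheory.

Theorem corollary4p17 (R : realType) (h : vectType R) (n : nat)
    (S : linear_coxeter_system h n) (Y : invariant_subcone S)
    (faithful : acts_faithfully Y) :
  let M : monoidType := face_monoid Y in
  let Lam : set M := [set eps F | F in ups Y] in
  let Sg : set M := range (gen_class Y) in
  [/\ renner_coxeter_system Lam Sg,
      exists phi : {multiplicative cox_group S -> unit_group M},
        bijective phi /\
        forall w : cox_group S, val (phi w) = class_eps w (face_top Y),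
      [/\ set_bij [set: face Y] (idempotents M) (fun F : face Y => eps F : M),
          forall F T : face Y, (eps (face_meet F T) : M) = eps F * eps T &
          forall F T : face Y,
            (F : set _) `<=` T <-> idem_le (eps F : M) (eps T)],
      injective (gen_class Y) &
      forall F : face Y, ups Y F ->
        [/\ type_map Sg (eps F) = gen_class Y @` ups_type F,
            lower_type_map Sg (eps F) = gen_class Y @` ups_lower F &
            upper_type_map Sg (eps F) = gen_class Y @` ups_upper F]].
Proof.
move=> M Lam Sg.
have unit_inj := cox_unit_inj faithful.
have idem_leE (F T : face Y) : F `<=` T <-> idem_le (eps F : M) (eps T).
  rewrite /idem_le !epsM (face_meetC T); split=> [/face_meet_idl ->//|[/eps_inj]].
  by move=> /face_meet_idl.
have typeE F i : gen_class Y i * (eps F : M) = eps F * gen_class Y i <-> ups_type F i.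
  by rewrite ups_typeE; exact: commute_eps.
have lowerE F i : (eps F : M) * gen_class Y i = eps F <-> ups_lower F i.
  exact: fix_eps.
have lower_type F i : ups_lower F i -> ups_type F i.
  by move=> /fix_commute/ups_typeE.
have gen_inj : injective (gen_class Y).
  by move=> i j ij; apply/(@cox_refl_inj _ _ _ S)/unit_inj/val_inj.
have typesE (F : face Y) :
    [/\ type_map Sg (eps F) = gen_class Y @` ups_type F,
        lower_type_map Sg (eps F) = gen_class Y @` ups_lower F &
        upper_type_map Sg (eps F) = gen_class Y @` ups_upper F].
  split; apply/seteqP; split.
  - by move=> _ [[i _ <-] /typeE iF]; exists i.
  - by move=> _ [i /typeE iF <-]; split=> //; exists i.
  - by move=> _ [[i _ <-] [_ /lowerE iF]]; exists i.
  - move=> _ [i iF <-]; split; first by exists i.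
    by split; [apply/typeE/lower_type|apply/lowerE].
  - by move=> _ [[i _ <-] [/typeE iF nF]]; exists i => //; split=> // /lowerE.
  - move=> _ [i [iF nF] <-]; split; first by exists i.
    by split; [apply/typeE|move=> /lowerE].
split=> //; last first.
- split=> //; last by move=> F T; rewrite epsM.
  split=> [F _|F T _ _ /eps_inj//|e /idempotentP[F ->]]; first exact: eps_idempotent.
  by exists F.
- exists (cox_unit Y); split=> //; rewrite -setTT_bijective.
  by split=> [//|w v _ _ /unit_inj|x _] //; have [w ->] := cox_unit_surj x; exists w.
split.
- exact: face_monoid_factorisable.
- by move=> _ [i _ <-]; exact: class_top_unit.
- exact: unit_coxeter_system.
- by move=> _ [F _ <-]; exact: eps_idempotent.
- by move=> _ _ [F uF <-] [T uT <-]; exists (face_meet F T); [exact: ups_meet|rewrite epsM].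
- move=> _ /idempotentP[F ->]; have [w uF] := ups_preim_ex F.
  exists (eps (face_preim w F)); split.
    split; first by exists (face_preim w F).
    by exists (cox_unit Y w); rewrite conj_eps -face_preimM mulgV face_preim1.
  move=> _ [[T uT <-] [x]]; have [v ->] := cox_unit_surj x.
  (* Both representatives are translates of [F], hence of each other by [v^-1 * w]. *)
  rewrite conj_eps => /eps_inj FE; congr eps; apply: (ups_preim_eq (w := (v^-1 * w)) uF uT).
  by rewrite face_preimM FE.
- move=> _ _ /idempotentP[F ->] /idempotentP[T ->] /idem_leE FT.
  have [w [uF uT]] := ups_preim_pair FT.
  exists (cox_unit Y w), (eps (face_preim w F)), (eps (face_preim w T)); split.
  + by exists (face_preim w F).
  + by exists (face_preim w T).
  + by apply/idem_leE => x; exact: FT.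
  + by rewrite conj_eps -face_preimM mulgV face_preim1.
  + by rewrite conj_eps -face_preimM mulgV face_preim1.
- move=> _ [F uF <-]; apply: (standard_parabolic_words (J := ups_type F)) => w /=.
  rewrite commute_eps; split=> [/(ups_stabilizer_word uF)//|[t tF ->]].
  by apply: face_preim_word => i /tF/ups_typeE.
- move=> _ [F uF <-]; apply: (standard_parabolic_words (J := ups_lower F)) => w.
  split=> [[_ /fix_eps/(ups_fixator_word uF)//]|[t tF ->]].
  have fixF := cox_word_fix tF.
  by split; [apply/commute_eps/fix_commute|apply/fix_eps].
- move=> _ _ [F uF <-] [T uT <-] /idem_leE FT.
  by have [_ _ ->] := typesE F; have [_ _ ->] := typesE T; apply/image_subset/ups_upper_sub.
Qed.
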